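(* Let $c\colon E^1\to G$ be a labeling of a row-finite directed graph $E=(E^0,E^1,r,s)$ by a discrete group $G$. Then the action $\gamma$ of $G$ on $C^*(E\times_cG)$ given by $\gamma_t(s_{(f,s)})=s_{(f,st^{-1})}$ and $\gamma_t(p_{(v,s)})=p_{(v,st^{-1})}$ (for $s,t\in G$, $f\in E^1$, $v\in E^0$) is amenable in the sense that the regular representation of the full crossed product $C^*(E\times_cG)\times_\gamma G$ (onto the reduced crossed product $C^*(E\times_cG)\times_{\gamma,r} G$) is faithful.
   Context: A directed graph $E=(E^0,E^1,r,s)$ consists of a set $E^0$ of vertices, a set $E^1$ of edges, and range and source maps $r,s\colon E^1\to E^0$. It is row-finite if $s^{-1}(v)$ is finite for every $v\in E^0$; sources and sinks are allowed (a sink is a vertex emitting no edges). A Cuntz-Krieger $E$-family in a $C^*$-algebra $B$ is a collection $\{t_f,q_v\mid f\in E^1,v\in E^0\}$ of partial isometries $t_f$ and mutually orthogonal projections $q_v$ in $B$ such that $t_f^*t_f=q_{r(f)}$ for each $f\in E^1$ and $q_v=\sum_{s(f)=v}t_ft_f^*$ for every $v\in E^0$ which is not a sink. $C^*(E)$ is the universal $C^*$-algebra generated by a Cuntz-Krieger $E$-family, and its canonical generators are denoted $\{s_f,p_v\}$. A labeling of $E$ by a group $G$ is a function $c\colon E^1\to G$. The skew-product graph $E\times_c G$ has vertex set $E^0\times G$, edge set $E^1\times G$, and range and source maps $r(f,t)=(r(f),t)$, $s(f,t)=(s(f),c(f)t)$. It is row-finite when $E$ is. *)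

(* Defs.v *)
From HB Require Import structures.
From mathcomp Require Import all_boot all_order all_algebra.
From mathcomp Require Import all_classical all_reals all_analysis.
From mathcomp Require Import complex.
Import Order.TTheory GRing.Theory Num.Theory.
Import numFieldNormedType.Exports.

Set Implicit Arguments.
Unset Strict Implicit.
Unset Printing Implicit Defensive.

Local Open Scope classical_set_scope.
Local Open Scope ring_scope.
Local Open Scope complex_scope.

(* Complex, not necessarily unital; the multiplication is part of the mixin
   because MathComp's algebra structures all have a unit.  Norms take their
   values in the nonnegative reals of [R[i]]. *)
HB.mixin Record CompleteNormedModule_isCStar (R : realType) A
    of CompleteNormedModule R[i] A := {
  cmul : A -> A -> A ;
  star : A -> A ;
  cmulA : associative cmul ;
  cmul_linearl : forall (k : R[i]) (a b c : A),
    cmul (k *: a + b) c = k *: cmul a c + cmul b c ;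
  cmul_linearr : forall (k : R[i]) (a b c : A),
    cmul c (k *: a + b) = k *: cmul c a + cmul c b ;
  starK : involutive star ;
  star_antilinear : forall (k : R[i]) (a b : A),
    star (k *: a + b) = (k^*)%R *: star a + star b ;
  starM : forall a b : A, star (cmul a b) = cmul (star b) (star a) ;
  cnormM : forall a b : A, `|cmul a b| <= `|a| * `|b| ;
  cnorm_star : forall a : A, `|cmul (star a) a| = `|a| ^+ 2
}.

#[short(type="cstarType")]
HB.structure Definition CStar (R : realType) :=
  {A of CompleteNormedModule_isCStar R A & CompleteNormedModule R[i] A}.

Notation "a '⋅' b" := (cmul a b) (at level 40, left associativity) : ring_scope.
Notation "a '^✶'" := (star a) (at level 2, format "a '^✶'") : ring_scope.

Section CStarTheory.
Variable R : realType.

Definition star_hom (A B : cstarType R) (h : A -> B) : Prop :=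
  [/\ linear h,
      {morph h : a b / a ⋅ b} &
      {morph h : a / a^✶}].

Definition closed_star_subalgebra (A : cstarType R) (S : set A) : Prop :=
  [/\ closed S,
      S 0,
      forall (k : R[i]) a b, S a -> S b -> S (k *: a + b),
      forall a b, S a -> S b -> S (a ⋅ b) &
      forall a, S a -> S (a^✶)].

Definition generates (A : cstarType R) (X : set A) : Prop :=
  forall S : set A, closed_star_subalgebra S -> X `<=` S -> S = setT.

Definition is_projection (A : cstarType R) (p : A) : Prop :=
  p ⋅ p = p /\ p^✶ = p.

Definition is_partial_isometry (A : cstarType R) (t : A) : Prop :=
  t ⋅ t^✶ ⋅ t = t.

Definition cstar_action (G : groupType) (A : cstarType R)
    (alpha : G -> A -> A) : Prop :=
  [/\ forall t, star_hom (alpha t),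
      forall a, alpha 1%g a = a &
      forall s t a, alpha (s * t)%g a = alpha s (alpha t a)].

End CStarTheory.

Record digraph := Digraph {
  vertex : choiceType ;
  edge : choiceType ;
  rng : edge -> vertex ;
  src : edge -> vertex
}.

Definition row_finite (E : digraph) : Prop :=
  forall v : vertex E, finite_set [set f | src f = v].

Definition is_sink (E : digraph) (v : vertex E) : Prop :=
  forall f, src f <> v.

Definition skew_product (E : digraph) (G : groupType) (c : edge E -> G) :
    digraph :=
  @Digraph (vertex E * G)%type (edge E * G)%type
    (fun ft => (rng ft.1, ft.2))
    (fun ft => (src ft.1, (c ft.1 * ft.2)%g)).

(* The sum over [src f = v] is a finite-support sum, which is the intended one
   only when [E] is row-finite. *)
Definition ck_family (R : realType) (E : digraph) (B : cstarType R)
    (t : edge E -> B) (q : vertex E -> B) : Prop :=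
  [/\ forall f, is_partial_isometry (t f),
      (forall v, is_projection (q v)) /\
        (forall v w, v <> w -> q v ⋅ q w = 0),
      forall f, (t f)^✶ ⋅ t f = q (rng f) &
      forall v, ~ is_sink v ->
        q v = \sum_(f \in [set f | src f = v]) (t f ⋅ (t f)^✶)].

(* [A], with canonical generators [s] and [p], is C*(E). *)
Definition graph_cstar (R : realType) (E : digraph) (A : cstarType R)
    (s : edge E -> A) (p : vertex E -> A) : Prop :=
  [/\ ck_family s p,
      generates (range s `|` range p) &
      forall (B : cstarType R) (t : edge E -> B) (q : vertex E -> B),
        ck_family t q ->
        exists h : A -> B,
          [/\ star_hom h, forall f, h (s f) = t f & forall v, h (p v) = q v]].

(* A *-homomorphism into [B] of the convolution *-algebra C_c(G, A), with
   [phi a t] the image of the function a.δ_t supported at [t]: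
     (a.δ_s)(b.δ_t) = (a alpha_s(b)).δ_st,
     (a.δ_s)^* = alpha_{s^-1}(a^* ).δ_{s^-1}. *)
Definition crossed_hom (R : realType) (G : groupType) (A B : cstarType R)
    (alpha : G -> A -> A) (phi : A -> G -> B) : Prop :=
  [/\ forall t, linear (phi^~ t),
      forall a s b t, phi a s ⋅ phi b t = phi (a ⋅ alpha s b) (s * t)%g &
      forall a s, (phi a s)^✶ = phi (alpha s^-1%g (a^✶)) s^-1%g].

(* [F] is the full crossed product of [A] by [alpha], i.e. the enveloping
   C*-algebra of C_c(G, A), with [j a t] the image of a.δ_t. *)
Definition full_crossed_product (R : realType) (G : groupType)
    (A : cstarType R) (alpha : G -> A -> A)
    (F : cstarType R) (j : A -> G -> F) : Prop :=
  [/\ crossed_hom alpha j,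
      generates [set x | exists a t, x = j a t] &
      forall (B : cstarType R) (phi : A -> G -> B), crossed_hom alpha phi ->
        exists h : F -> B, star_hom h /\ forall a t, h (j a t) = phi a t].

(* The inner product is linear in its first argument. *)
HB.mixin Record CompleteNormedModule_isHilbert (R : realType) H
    of CompleteNormedModule R[i] H := {
  hdot : {dot H for (@Num.conj R[i])} ;
  hdot_norm : forall x : H, hdot x x = `|x| ^+ 2
}.

#[short(type="hilbertType")]
HB.structure Definition Hilbert (R : realType) :=
  {H of CompleteNormedModule_isHilbert R H & CompleteNormedModule R[i] H}.

Section Representations.
Variable R : realType.

Definition representation (A : cstarType R) (H : hilbertType R)
    (pi : A -> H -> H) : Prop :=
  [/\ forall a, linear (pi a) /\ continuous (pi a),
      forall (k : R[i]) a b x, pi (k *: a + b) x = k *: pi a x + pi b x,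
      forall a b x, pi (a ⋅ b) x = pi a (pi b x) &
      forall a x y, hdot (pi a x) y = hdot x (pi (a^✶) y)].

Definition faithful (A : cstarType R) (H : hilbertType R)
    (pi : A -> H -> H) : Prop := injective pi.

(* [K] is l^2(G, H), the Hilbert space direct sum of copies of [H] indexed
   by [G]; [J t x] is the function with value [x] at [t] and 0 elsewhere. *)
Definition ell2_space (G : groupType) (H K : hilbertType R)
    (J : G -> H -> K) : Prop :=
  [/\ forall t, linear (J t),
      forall t x y, hdot (J t x) (J t y) = hdot x y,
      forall s t x y, s <> t -> hdot (J s x) (J t y) = 0 &
      forall S : set K, closed S -> S 0 ->
        (forall (k : R[i]) u v, S u -> S v -> S (k *: u + v)) ->
        (forall t x, S (J t x)) -> S = setT].

(* The covariant pair of operators on l^2(G, H) induced from [pi]: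
     (pit(a) xi)(t) = pi(alpha_{t^-1}(a)) xi(t),  (lam_s xi)(t) = xi(s^-1 t). *)
Definition regular_pair (G : groupType) (A : cstarType R)
    (alpha : G -> A -> A) (H K : hilbertType R) (pi : A -> H -> H)
    (J : G -> H -> K) (pit : A -> K -> K) (lam : G -> K -> K) : Prop :=
  [/\ representation pit,
      forall s, linear (lam s) /\ continuous (lam s),
      forall a t x, pit a (J t x) = J t (pi (alpha t^-1%g a) x) &
      forall s t x, lam s (J t x) = J (s * t)%g x].

(* The regular representation of the full crossed product on l^2(G, H), the
   integrated form of the pair above: a.δ_s acts by pit(a) lam_s. *)
Definition regular_representation (G : groupType) (A : cstarType R)
    (alpha : G -> A -> A) (F : cstarType R) (j : A -> G -> F)
    (H K : hilbertType R) (pi : A -> H -> H) (J : G -> H -> K)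
    (Lam : F -> K -> K) : Prop :=
  representation Lam /\
  exists (pit : A -> K -> K) (lam : G -> K -> K),
    regular_pair alpha pi J pit lam /\
    forall a s xi, Lam (j a s) xi = pit a (lam s xi).

(* The reduced crossed product is the image of the regular representation
   induced from any faithful representation of [A]. *)
Definition amenable_action (G : groupType) (A : cstarType R)
    (alpha : G -> A -> A) : Prop :=
  forall (F : cstarType R) (j : A -> G -> F), full_crossed_product alpha j ->
  forall (H : hilbertType R) (pi : A -> H -> H),
    representation pi -> faithful pi ->
  forall (K : hilbertType R) (J : G -> H -> K), ell2_space J ->
  forall Lam : F -> K -> K,
    regular_representation alpha j pi J Lam -> faithful Lam.

End Representations.

(* Main.v *)
Require Import Defs.
From mathcomp Require Import all_boot all_order all_algebra.
From mathcomp Require Import all_classical all_reals all_analysis.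
From mathcomp Require Import complex finmap cyclic separable cyclotomic.
From mathcomp Require Import ring lra zify.
Import Order.TTheory GRing.Theory Num.Theory.
Import numFieldNormedType.Exports.

(* Write [ker] for the kernel of the regular representation. The full
   crossed product [F] is densely spanned by the elements [j a t] with [a]
   the product of a path [b] by the adjoint of a path [b'] with the same
   range. These multiply like matrix units, and [F] carries a gauge action
   of the circle, for which such an element has degree [|b| - |b'|]. It
   suffices to prove [|y| <= |y - x|] for [x] in [ker] and [y] in this span,
   and for self-adjoint [y] one may do so up to a factor growing
   subexponentially in [N] after replacing [y] by [y ^ N], since [y ^ N] is
   congruent to [(y - x) ^ N] modulo [ker].

   If [y] has degree 0, all its powers have coefficients supported in one
   finite subset [T] of [G], because by row-finiteness only finitely many
   paths of bounded length leave a finite set of vertices. The Fourier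
   coefficients are contractive for the reduced norm, faithful
   representations being isometric; so the factor is [#|T|]. Degree [d]
   reduces to degree 0 through [y^* y]. In general [y ^ N] has O(N)
   homogeneous components, each an average over roots of unity of gauge
   automorphisms, and these preserve [ker]; so the factor is O(N). *)

Set Implicit Arguments.
Unset Strict Implicit.
Unset Printing Implicit Defensive.

Local Open Scope classical_set_scope.
Local Open Scope ring_scope.
Local Open Scope complex_scope.

(** * Real-valued norms and adherent points *)

Definition rnorm (R : realType) (V : normedModType R[i]) (x : V) : R :=
  complex.Re `|x|.
Notation "`‖ x ‖" := (rnorm x) (at level 0, x at level 99, format "`‖ x ‖").

Lemma conjC_real_complex (R : realType) (x : R) : ((x%:C)^*)%R = x%:C.
Proof. exact: conjc_real. Qed.

Section RealNorm.
Variables (R : realType) (V : normedModType R[i]).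
Implicit Types (x y z : V).

Lemma rnormE x : `|x| = `‖x‖%:C.
Proof. by rewrite /rnorm RRe_real // ger0_real. Qed.

Lemma rnorm_ge0 x : 0 <= `‖x‖.
Proof. by rewrite -ler0c -rnormE. Qed.

Lemma rnorm0 : `‖0 : V‖ = 0.
Proof. by rewrite /rnorm normr0. Qed.

Lemma rnorm0_eq0 x : `‖x‖ = 0 -> x = 0.
Proof. by move=> x0; apply: normr0_eq0; rewrite rnormE x0. Qed.

Lemma rnormN x : `‖- x‖ = `‖x‖.
Proof. by rewrite /rnorm normrN. Qed.

Lemma rnormB_sym x y : `‖x - y‖ = `‖y - x‖.
Proof. by rewrite /rnorm distrC. Qed.

Lemma ler_rnormD x y : `‖x + y‖ <= `‖x‖ + `‖y‖.
Proof. by rewrite -lecR rmorphD /= -!rnormE ler_normD. Qed.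

Lemma rnormZ (k : R[i]) x : `‖k *: x‖ = complex.Re `|k| * `‖x‖.
Proof.
rewrite /rnorm normrZ -[ `|k|]RRe_real ?ger0_real//.
rewrite -[ `|x|]RRe_real ?ger0_real//.
by rewrite -rmorphM.
Qed.

Lemma rnormZR (k : R) x : `‖k%:C *: x‖ = `|k| * `‖x‖.
Proof.
rewrite rnormZ; congr (_ * _).
by rewrite normc_def /= expr0n /= addr0 sqrtr_sqr.
Qed.

Lemma rnorm_dbl x : `‖x + x‖ = `‖x‖ + `‖x‖.
Proof. by rewrite /rnorm -mulr2n normrMn !mulr2n raddfD. Qed.

Lemma rnormZ1 (k : R[i]) x : `|k| = 1 -> `‖k *: x‖ = `‖x‖.
Proof. by move=> k1; rewrite rnormZ k1 mul1r. Qed.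

Lemma ler_rnorm_sum (I : Type) (r : seq I) (P : pred I) (F : I -> V) :
  `‖\sum_(i <- r | P i) F i‖ <= \sum_(i <- r | P i) `‖F i‖.
Proof.
elim/big_ind2: _ => [|x a y b xa yb|//]; first by rewrite rnorm0.
by apply: le_trans (ler_rnormD _ _) _; exact: lerD.
Qed.

Lemma rnorm_approx0 x : (forall e : R, 0 < e -> `‖x‖ <= e) -> x = 0.
Proof.
move=> xe; apply/rnorm0_eq0/eqP; rewrite eq_le rnorm_ge0 andbT.
by apply/ler_addgt0Pl => e e0; rewrite addr0 xe.
Qed.

(** The closure of [S], phrased with real tolerances so that approximation arguments stay within
    real arithmetic. *)
Definition adherent (S : set V) x :=
  forall e : R, 0 < e -> exists2 y, S y & `‖x - y‖ <= e.

Lemma subset_adherent (S : set V) : S `<=` adherent S.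
Proof. by move=> x Sx e e0; exists x; rewrite // subrr rnorm0 ltW. Qed.

Lemma adherentK (S : set V) x : adherent (adherent S) x -> adherent S x.
Proof.
move=> Sx e e0; have e20 : 0 < e / 2 by rewrite divr_gt0.
have [y Sy xy] := Sx _ e20; have [z Sz yz] := Sy _ e20.
exists z => //; rewrite [e]splitr -(subrKA y).
exact: le_trans (ler_rnormD _ _) (lerD _ _).
Qed.

Lemma closed_rnormP (S : set V) : adherent S `<=` S -> closed S.
Proof.
move=> SS x clx; apply: SS => e e0.
have [y [Sy]] : S `&` ball x e%:C !=set0.
  by apply: clx; apply: nbhsx_ballx; rewrite ltcR.
rewrite -ball_normE /= => xy; exists y => //.
by rewrite rnormE ltcR in xy; exact: ltW.
Qed.

Lemma closed_adherent (S : set V) : closed (adherent S).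
Proof. by apply: closed_rnormP => x; exact: adherentK. Qed.

End RealNorm.

Lemma rnorm_cauchy_cvg (R : realType) (V : completeNormedModType R[i])
    (u : nat -> V) :
  (forall e : R, 0 < e ->
    exists n, forall m, (n <= m)%N -> `‖u n - u m‖ <= e) ->
  exists l, forall e : R, 0 < e ->
    exists n, forall m, (n <= m)%N -> `‖l - u m‖ <= e.
Proof.
move=> cu; have /cvg_ex[l ul] : cvg (u @ \oo).
  apply/cauchy_cvgP/cauchy_exP => e e0.
  have er : e = (complex.Re e)%:C by rewrite RRe_real// gtr0_real.
  have re0 : 0 < complex.Re e / 2 by rewrite divr_gt0// -ltcR -er.
  have [n nu] := cu _ re0; exists (u n); exists n => // m /= nm.
  rewrite -ball_normE /= rnormE er ltcR.
  by apply: le_lt_trans (nu m nm) _; lra.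
exists l => e e0; have e0c : 0 < e%:C by rewrite ltcR.
have [n _ nl] := cvgr_dist_le _ _ ul _ e0c.
by exists n => m nm; rewrite -lecR -rnormE; exact: nl.
Qed.

(** * Deciding identities in abelian groups by reflection *)

Inductive zexpr := ZVar of nat | ZAdd of zexpr & zexpr | ZOpp of zexpr | ZZero.

Fixpoint zexpr_eval (V : zmodType) (env : seq V) (e : zexpr) : V :=
  match e with
  | ZVar n => env`_n
  | ZAdd a b => zexpr_eval env a + zexpr_eval env b
  | ZOpp a => - zexpr_eval env a
  | ZZero => 0
  end.

Fixpoint zexpr_coef (e : zexpr) (i : nat) : int :=
  match e with
  | ZVar n => (n == i)%:R
  | ZAdd a b => zexpr_coef a i + zexpr_coef b i
  | ZOpp a => - zexpr_coef a i
  | ZZero => 0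
  end.

Lemma zexpr_evalE (V : zmodType) (env : seq V) (e : zexpr) :
  zexpr_eval env e = \sum_(i < size env) env`_i *~ zexpr_coef e i.
Proof.
elim: e => /= [n|a -> b ->|a ->|].
- have [n_lt|n_ge] := ltnP n (size env).
    rewrite (bigD1 (Ordinal n_lt)) //= eqxx mulr1z big1 ?addr0// => i.
    by rewrite -val_eqE /= eq_sym => /negPf ->; rewrite mulr0z.
  rewrite nth_default// big1// => i _.
  by rewrite gtn_eqF ?mulr0z// (leq_trans _ n_ge).
- by rewrite -big_split; apply: eq_bigr => i _; rewrite mulrzDr.
- by rewrite -sumrN; apply: eq_bigr => i _; rewrite mulrNz.
- by rewrite big1// => i _; rewrite mulr0z.
Qed.

Lemma zexpr_eq (V : zmodType) (env : seq V) (e f : zexpr) :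
  all (fun i => zexpr_coef e i == zexpr_coef f i) (iota 0 (size env)) ->
  zexpr_eval env e = zexpr_eval env f.
Proof.
move=> /allP ef; rewrite !zexpr_evalE; apply: eq_bigr => i _.
by rewrite (eqP (ef i _))// mem_iota add0n leq0n ltn_ord.
Qed.

(* Atoms are compared up to conversion, since the same scaling may appear
   through several canonical instances. *)
Ltac zexpr_index x env :=
  match env with
  | ?y :: _ => let _ := match goal with _ => unify x y end in constr:(0%N)
  | _ :: ?env' => let n := zexpr_index x env' in constr:(S n)
  end.

Ltac zexpr_mem x env :=
  match env with
  | ?y :: _ => let _ := match goal with _ => unify x y end in constr:(true)
  | _ :: ?env' => zexpr_mem x env'
  | _ => constr:(false)
  end.

Ltac zexpr_env t env :=
  lazymatch t with
  | ?a + ?b => let env' := zexpr_env a env in zexpr_env b env'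
  | - ?a => zexpr_env a env
  | 0 => env
  | _ => lazymatch zexpr_mem t env with
         | true => env
         | false => constr:(t :: env)
         end
  end.

Ltac zexpr_reify t env :=
  lazymatch t with
  | ?a + ?b => let a' := zexpr_reify a env in let b' := zexpr_reify b env in
               constr:(ZAdd a' b')
  | - ?a => let a' := zexpr_reify a env in constr:(ZOpp a')
  | 0 => constr:(ZZero)
  | _ => let n := zexpr_index t env in constr:(ZVar n)
  end.

(* Decides equalities in the theory of abelian groups. *)
Ltac zmod :=
  lazymatch goal with
  | |- @eq ?T ?a ?b =>
    let env := zexpr_env a (@nil T) in
    let env := zexpr_env b env in
    let a' := zexpr_reify a env in
    let b' := zexpr_reify b env in
    exact: (@zexpr_eq _ env a' b' isT)
  end.

(** * Linear maps and elementary C*-algebra identities *)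

Section LinearMaps.
Variables (K : pzRingType) (U V : lmodType K) (h : U -> V).
Hypothesis hlin : linear h.

Lemma linmapD x y : h (x + y) = h x + h y.
Proof. by have := hlin 1 x y; rewrite !scale1r. Qed.

Lemma linmap0 : h 0 = 0.
Proof. by apply: (addIr (h 0)); rewrite -linmapD !add0r. Qed.

Lemma linmapZ k x : h (k *: x) = k *: h x.
Proof. by rewrite -[k *: x]addr0 hlin linmap0 addr0. Qed.

Lemma linmapN x : h (- x) = - h x.
Proof. by rewrite -scaleN1r linmapZ scaleN1r. Qed.

Lemma linmapB x y : h (x - y) = h x - h y.
Proof. by rewrite linmapD linmapN. Qed.

Lemma linmap_sum (I : Type) (r : seq I) (P : pred I) (F : I -> U) :
  h (\sum_(i <- r | P i) F i) = \sum_(i <- r | P i) h (F i).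
Proof. exact: (big_morph h linmapD linmap0). Qed.

End LinearMaps.

Section CStarBasics.
Variables (R : realType) (A : cstarType R).
Implicit Types (a b c x y z : A) (k : R[i]).

Lemma cmul_linl c : linear (fun a : A => a ⋅ c).
Proof. by move=> k a b; exact: cmul_linearl. Qed.

Lemma cmul_linr c : linear (fun a : A => c ⋅ a).
Proof. by move=> k a b; exact: cmul_linearr. Qed.

Definition cmulDl a b c : (a + b) ⋅ c = a ⋅ c + b ⋅ c :=
  linmapD (cmul_linl c) a b.
Definition cmulDr a b c : c ⋅ (a + b) = c ⋅ a + c ⋅ b :=
  linmapD (cmul_linr c) a b.
Definition cmulBl a b c : (a - b) ⋅ c = a ⋅ c - b ⋅ c :=
  linmapB (cmul_linl c) a b.
Definition cmulBr a b c : c ⋅ (a - b) = c ⋅ a - c ⋅ b :=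
  linmapB (cmul_linr c) a b.
Definition cmulNl a c : (- a) ⋅ c = - (a ⋅ c) := linmapN (cmul_linl c) a.
Definition cmulNr a c : c ⋅ (- a) = - (c ⋅ a) := linmapN (cmul_linr c) a.
Definition cmulZl k a c : (k *: a) ⋅ c = k *: (a ⋅ c) :=
  linmapZ (cmul_linl c) k a.
Definition cmulZr k a c : c ⋅ (k *: a) = k *: (c ⋅ a) :=
  linmapZ (cmul_linr c) k a.
Definition cmul0l c : 0 ⋅ c = 0 := linmap0 (cmul_linl c).
Definition cmul0r c : c ⋅ 0 = 0 := linmap0 (cmul_linr c).

Lemma starD a b : (a + b)^✶ = a^✶ + b^✶.
Proof. by have := star_antilinear 1 a b; rewrite rmorph1 !scale1r. Qed.

Lemma star0 : (0 : A)^✶ = 0.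
Proof. by apply: (addIr (0 : A)^✶); rewrite -starD !add0r. Qed.

Lemma starZ k a : (k *: a)^✶ = (k^*)%R *: a^✶.
Proof. by rewrite -[k *: a]addr0 star_antilinear star0 addr0. Qed.

Lemma starN a : (- a)^✶ = - a^✶.
Proof. by rewrite -scaleN1r starZ rmorphN1 scaleN1r. Qed.

Lemma starB a b : (a - b)^✶ = a^✶ - b^✶.
Proof. by rewrite starD starN. Qed.

Lemma rnormM a b : `‖a ⋅ b‖ <= `‖a‖ * `‖b‖.
Proof. by rewrite -lecR rmorphM /= -!rnormE cnormM. Qed.

Lemma rnorm_star_mul a : `‖a^✶ ⋅ a‖ = `‖a‖ ^+ 2.
Proof. by apply: complexI; rewrite rmorphXn /= -!rnormE cnorm_star. Qed.

Lemma rnorm_star a : `‖a^✶‖ = `‖a‖.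
Proof.
suff le b : `‖b‖ <= `‖b^✶‖.
  by apply/eqP; rewrite eq_le le andbT -{2}[a]starK le.
have := rnorm_ge0 b; rewrite le_eqVlt => /predU1P[<-|b0].
  exact: rnorm_ge0.
by rewrite -(ler_pM2r b0) -expr2 -rnorm_star_mul rnormM.
Qed.

Lemma rnorm_sa a : a^✶ = a -> `‖a ⋅ a‖ = `‖a‖ ^+ 2.
Proof. by move=> {1}<-; exact: rnorm_star_mul. Qed.

(** At [b = a^✶] the C*-identity turns the hypothesis into [|a|^2 <= C |a|]. Elements of the
    unitization can thus be handled as operators on [A]. *)
Lemma rnorm_unit_ball_le (C : R) a : 0 <= C ->
  (forall b, `‖a ⋅ b‖ <= C * `‖b‖) -> `‖a‖ <= C.
Proof.
move=> C0 aC; have := rnorm_ge0 a; rewrite le_eqVlt => /predU1P[<-//|a0].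
have := aC a^✶; rewrite -{1}[a]starK rnorm_star_mul rnorm_star expr2.
by rewrite ler_pM2r.
Qed.

End CStarBasics.

(** * Square roots and automatic contractivity in C*-algebras *)

Section SquareRoot.
Variables (R : realType) (A : cstarType R) (v : A).

(* [1 - c] is a square root of [1 - v]; the iterates are those of the recursion
   [c := (v + c ^ 2) / 2], dominated by the scalar recursion at [v = 1]. *)
Let u n := iter n (fun c : A => (2^-1)%:C *: (v + c ⋅ c)) 0.
Let r n := iter n (fun x : R => (1 + x ^+ 2) / 2) 0.

Lemma cstar_sqrt : v^✶ = v -> `‖v‖ <= 1 -> exists c : A,
  [/\ c^✶ = c, `‖c‖ <= 1, c + c - c ⋅ c = v &
      forall b, b ⋅ v = v ⋅ b -> b ⋅ c = c ⋅ b].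
Proof.
move=> vsa v1.
have r01 n : 0 <= r n <= 1.
  by elim: n => [|n /= /andP[r0 r1]]; rewrite /= ?lexx ?ler01//; nra.
have rS n : r n <= r n.+1 by have := r01 n; rewrite /=; nra.
have ndr : {homo r : m n / (m <= n)%N >-> m <= n}.
  by apply: (homo_leq (@lexx _ _) (@le_trans _ _)).
have ur n : `‖u n‖ <= r n.
  elim: n => [|n IH]; first by rewrite rnorm0.
  rewrite /= rnormZR ger0_norm// mulrC ler_pM2r//.
  apply: le_trans (ler_rnormD _ _) _; apply: lerD => //.
  apply: le_trans (rnormM _ _) _.
  by rewrite expr2; apply: ler_pM => //; exact: rnorm_ge0.
have usa n : (u n)^✶ = u n.
  elim: n => [|n IH]; first by rewrite star0.
  by rewrite /= starZ starD starM vsa IH conjC_real_complex.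
have uc n b : b ⋅ v = v ⋅ b -> b ⋅ u n = u n ⋅ b.
  move=> bv; elim: n => [|n IH]; first by rewrite cmul0l cmul0r.
  by rewrite /= cmulZr cmulZl cmulDr cmulDl bv cmulA IH -cmulA IH cmulA.
(* Increments of [u] are dominated by those of [r], which is monotone and bounded; hence [u] is
   Cauchy. The squares are compared by [x^2 - y^2 = x (x - y) + (x - y) y]. *)
have uS n : `‖u n.+1 - u n‖ <= r n.+1 - r n.
  elim: n => [|n IH]; first by rewrite !subr0 ur.
  have -> : u n.+2 - u n.+1 = (2^-1)%:C *: (u n.+1 ⋅ (u n.+1 - u n)
      + (u n.+1 - u n) ⋅ u n).
    rewrite cmulBr cmulBl subrKA /= -scalerBr; congr (_ *: _).
    by rewrite opprD addrACA subrr add0r.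
  rewrite rnormZR ger0_norm//.
  have -> : r n.+2 - r n.+1 = 2^-1 * (r n.+1 * (r n.+1 - r n)
      + (r n.+1 - r n) * r n) by rewrite /=; ring.
  rewrite ler_pM2l//; apply: le_trans (ler_rnormD _ _) _.
  apply: lerD; apply: le_trans (rnormM _ _) _;
    by apply: ler_pM => //; exact: rnorm_ge0.
have uD n m : (n <= m)%N -> `‖u n - u m‖ <= r m - r n.
  move=> /subnK <-; elim: (m - n)%N => [|k IH].
    by rewrite !subrr rnorm0.
  rewrite rnormB_sym -(subrKA (u (k + n)%N)) addSn.
  apply: le_trans (ler_rnormD _ _) _.
  rewrite -[leRHS](subrKA (r (k + n)%N)); apply: lerD; first exact: uS.
  by rewrite rnormB_sym.
have [c uc0] : exists c, forall e : R, 0 < e ->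
    exists n, forall m, (n <= m)%N -> `‖c - u m‖ <= e.
  apply: rnorm_cauchy_cvg => e e0.
  have rcvg : cvgn r.
    apply: nondecreasing_is_cvgn => //; exists 1 => _ [n _ <-].
    by case/andP: (r01 n).
  have [n _ nr] := cvgr_dist_le _ _ rcvg _ e0.
  exists n => m nm; apply: le_trans (uD _ _ nm) _.
  apply: le_trans (nr n _) => //=.
  rewrite ger0_norm ?subr_ge0; last exact: nondecreasing_cvgn_le.
  by rewrite lerB// nondecreasing_cvgn_le.
have uc1 (e : R) : 0 < e -> exists n, `‖c - u n‖ <= e /\ `‖c - u n.+1‖ <= e.
  by move=> /uc0[n nc]; exists n; split; apply: nc.
have c1 : `‖c‖ <= 1.
  apply/ler_addgt0Pl => e e0; have [n [ce _]] := uc1 _ e0.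
  rewrite -[c](subrK (u n)); apply: le_trans (ler_rnormD _ _) (lerD ce _).
  by apply: le_trans (ur n) _; case/andP: (r01 n).
exists c; split => //.
- apply/subr0_eq/rnorm_approx0 => e e0.
  have e20 : 0 < e / 2 by rewrite divr_gt0.
  have [n [ce _]] := uc1 _ e20.
  rewrite -(subrKA (u n)) -{1}usa -starB [e]splitr.
  apply: le_trans (ler_rnormD _ _) (lerD _ _); first by rewrite rnorm_star.
  by rewrite rnormB_sym.
- apply/subr0_eq/rnorm_approx0 => e e0.
  (* Solving the recursion for [v] leaves four errors: [c - u n.+1] twice, and [c - u n] multiplied
     by [c] and by [u n]. *)
  have e4 : 0 < e / 4 by rewrite divr_gt0.
  have [n [ce ce']] := uc1 _ e4.
  have -> : c + c - c ⋅ c - v = (c - u n.+1) + (c - u n.+1)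
      - (c ⋅ (c - u n) + (c - u n) ⋅ u n).
    have -> : v = u n.+1 + u n.+1 - u n ⋅ u n.
      rewrite /= -scalerDl -rmorphD /=.
      have -> : 2^-1 + 2^-1 = 1 :> R by lra.
      by rewrite scale1r; zmod.
    by rewrite cmulBr cmulBl; zmod.
  have cce : `‖c ⋅ (c - u n)‖ <= e / 4.
    apply: le_trans (rnormM _ _) _; rewrite -[leRHS]mul1r.
    by apply: ler_pM => //; exact: rnorm_ge0.
  have cue : `‖(c - u n) ⋅ u n‖ <= e / 4.
    apply: le_trans (rnormM _ _) _; rewrite -[leRHS]mulr1.
    apply: ler_pM => //; try exact: rnorm_ge0.
    by apply: le_trans (ur n) _; case/andP: (r01 n).
  apply: le_trans (ler_rnormD _ _) _; rewrite rnormN.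
  have := ler_rnormD (c - u n.+1) (c - u n.+1).
  have := ler_rnormD (c ⋅ (c - u n)) ((c - u n) ⋅ u n).
  lra.
- move=> b bv; apply/subr0_eq/rnorm_approx0 => e e0.
  have d0 : 0 < e / (`‖b‖ + `‖b‖ + 1).
    by rewrite divr_gt0//; have := rnorm_ge0 b; lra.
  have [n [ce _]] := uc1 _ d0.
  have -> : b ⋅ c - c ⋅ b = b ⋅ (c - u n) - (c - u n) ⋅ b.
    by rewrite cmulBr cmulBl uc//; zmod.
  apply: le_trans (ler_rnormD _ _) _; rewrite rnormN.
  apply: le_trans (lerD (rnormM _ _) (rnormM _ _)) _.
  rewrite [X in _ + X]mulrC -mulrDl.
  apply: le_trans (ler_wpM2l (addr_ge0 (rnorm_ge0 _) (rnorm_ge0 _)) ce) _.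
  rewrite mulrCA -[leRHS]mulr1 ler_wpM2l ?(ltW e0)//.
  by rewrite ler_pdivrMr ?mul1r ?lerDl//; have := rnorm_ge0 b; lra.
Qed.
End SquareRoot.

Section UnitaryDilation.
Variables (R : realType) (A : cstarType R) (a c : A).
Hypotheses (asa : a^✶ = a) (csa : c^✶ = c) (ac : a ⋅ c = c ⋅ a).
Hypothesis (cE : c + c - c ⋅ c = a ⋅ a).

Let aab b : a ⋅ (a ⋅ b) = c ⋅ b + c ⋅ b - c ⋅ (c ⋅ b).
Proof. by rewrite cmulA -cE cmulBl cmulDl cmulA. Qed.

Let acb b : a ⋅ (c ⋅ b) = c ⋅ (a ⋅ b).
Proof. by rewrite !cmulA ac. Qed.

(* The element [a + i (1 - c)] of the unitization is unitary, because
   [a ^ 2 + (1 - c) ^ 2 = 1]. *)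
Lemma rnorm_unitary_mul b : `‖a ⋅ b + 'i%R *: (b - c ⋅ b)‖ = `‖b‖.
Proof.
apply/eqP; rewrite -(@eqrXn2 _ 2)// ?rnorm_ge0// -!rnorm_star_mul; apply/eqP.
congr rnorm; rewrite starD starZ starM starB starM asa csa conjCi.
rewrite !scalerBr !scaleNr.
rewrite !(cmulDl, cmulDr, cmulBl, cmulBr, cmulNl, cmulNr, cmulZl, cmulZr).
rewrite -!cmulA aab acb !scalerA mulCii !scaleN1r.
by rewrite !(cmulDl, cmulDr, cmulBl, cmulBr, cmulNl, cmulNr); zmod.
Qed.

End UnitaryDilation.

Section SelfAdjoint.
Variables (R : realType) (A : cstarType R) (a c : A).
Hypotheses (asa : a^✶ = a) (csa : c^✶ = c) (ac : a ⋅ c = c ⋅ a).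
Hypothesis (cE : c + c - c ⋅ c = a ⋅ a).

Lemma rnorm_unitary_mulN b : `‖- (a ⋅ b) + 'i%R *: (b - c ⋅ b)‖ = `‖b‖.
Proof.
rewrite -cmulNl; apply: rnorm_unitary_mul => //; first by rewrite starN asa.
  by rewrite cmulNl cmulNr ac.
by rewrite cmulNl cmulNr opprK.
Qed.

(** [2 a] is the difference of the isometric multiplications by [a + i (1 - c)] and
    [- a + i (1 - c)]. *)
Lemma rnorm_cos_le1 : `‖a‖ <= 1.
Proof.
apply: rnorm_unit_ball_le => // b; rewrite mul1r.
have -> : `‖a ⋅ b‖ = (`‖a ⋅ b‖ + `‖a ⋅ b‖) / 2 by lra.
rewrite -rnorm_dbl.
have -> : a ⋅ b + a ⋅ b = (a ⋅ b + 'i%R *: (b - c ⋅ b))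
    - (- (a ⋅ b) + 'i%R *: (b - c ⋅ b)) by zmod.
have := ler_rnormD (a ⋅ b + 'i%R *: (b - c ⋅ b))
  (- (- (a ⋅ b) + 'i%R *: (b - c ⋅ b))).
by rewrite rnormN rnorm_unitary_mulN rnorm_unitary_mul//; lra.
Qed.

(* With [a = cos t] and [1 - c = sin t], this is [sin (2 t)]. *)
Lemma rnorm_sin2_le1 : `‖(a - a ⋅ c) + (a - a ⋅ c)‖ <= 1.
Proof.
apply: rnorm_unit_ball_le => // b; rewrite mul1r.
pose U x := a ⋅ x + 'i%R *: (x - c ⋅ x).
pose U' x := - (a ⋅ x) + 'i%R *: (x - c ⋅ x).
(* The operators [U] and [U'] commute, so [U^2 - U'^2 = 4 i a (1 - c) = 2 i y], and both squares are
   isometric. *)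
set y := _ + _; have iE : 'i%R *: (y ⋅ b) + 'i%R *: (y ⋅ b) =
    U (U b) - U' (U' b).
  rewrite /U /U' /y !(scalerBr, scalerDr, scalerN).
  rewrite !(cmulDl, cmulDr, cmulBl, cmulBr, cmulNl, cmulNr, cmulZl, cmulZr).
  rewrite -!cmulA !(scalerBr, scalerDr, scalerN) !cmulA ac.
  zmod.
have := ler_rnormD (U (U b)) (- U' (U' b)).
rewrite -iE rnorm_dbl rnormZ1 ?normCi// rnormN.
by rewrite !rnorm_unitary_mulN !rnorm_unitary_mul//; lra.
Qed.

(** With [a = cos t] one has [1 - w = - cos (2 t)], so this is [sin^2 (2 t) = 1 - cos^2 (2 t)]: the
    element [1 - w] is a square root of [1 - y^2]. *)
Lemma sin2_sqr (w := a ⋅ a + a ⋅ a) (y := (a - a ⋅ c) + (a - a ⋅ c)) :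
  y ⋅ y = w + w - w ⋅ w.
Proof.
have aacc : a ⋅ c ⋅ (a ⋅ c) = a ⋅ a ⋅ c + a ⋅ a ⋅ c - a ⋅ a ⋅ (a ⋅ a).
  rewrite -cmulA [c ⋅ _]cmulA -ac !cmulA -(cmulA (a ⋅ a) c c).
  have -> : c ⋅ c = c + c - a ⋅ a by rewrite -cE; zmod.
  by rewrite cmulBr cmulDr !cmulA.
rewrite /w /y !(cmulDl, cmulDr, cmulNl, cmulNr) aacc.
by rewrite -!cmulA -ac; zmod.
Qed.

End SelfAdjoint.

Section StarHom.
Variables (R : realType) (A B : cstarType R) (h : A -> B).
Hypothesis hh : star_hom h.

(** For self-adjoint [x] in the unit ball, [h] preserves the relation [2 c - c^2 = x^2], so [h x] is
    again the cosine part of a unitary. Scaling and the C*-identity give the general case. *)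
Lemma star_hom_rnorm a : `‖h a‖ <= `‖a‖.
Proof.
have [hl hM hs] := hh.
have small x : x^✶ = x -> `‖x‖ <= 1 -> `‖h x‖ <= 1.
  move=> xsa x1; have [||c [csa _ cE cx]] := @cstar_sqrt R A (x ⋅ x).
  - by rewrite starM xsa.
  - by rewrite rnorm_sa// expr_le1// rnorm_ge0.
  apply: (@rnorm_cos_le1 _ _ _ (h c)); rewrite -?hs ?xsa ?csa -?hM//.
    by rewrite cx// cmulA.
  by rewrite -cE (linmapB hl) (linmapD hl).
have sa x : x^✶ = x -> `‖h x‖ <= `‖x‖.
  move=> xsa; have := rnorm_ge0 x; rewrite le_eqVlt => /predU1P[/esym|] x0.
    by rewrite (rnorm0_eq0 x0) (linmap0 hl) !rnorm0.
  rewrite -[leRHS]mulr1 -ler_pdivrMl// -[_^-1]ger0_norm ?invr_ge0 ?(ltW x0)//.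
  rewrite -rnormZR.
  rewrite -(linmapZ hl); apply: small.
    by rewrite starZ xsa conjC_real_complex.
  by rewrite rnormZR ger0_norm ?invr_ge0 ?(ltW x0)// mulVf ?gt_eqF.
rewrite -(@ler_pXn2r _ 2)// ?nnegrE ?rnorm_ge0// -!rnorm_star_mul -hs -hM.
by apply: sa; rewrite starM starK.
Qed.

End StarHom.

(** * The real inner product of a Hilbert space *)

Lemma ReD (R : realType) (u v : R[i]) :
  complex.Re (u + v) = complex.Re u + complex.Re v.
Proof. by case: u v => ? ? []. Qed.

Lemma ReM_real (R : realType) (k : R) (u : R[i]) :
  complex.Re (k%:C * u) = k * complex.Re u.
Proof. by case: u => a b /=; rewrite mul0r subr0. Qed.

Lemma Re_conj (R : realType) (u : R[i]) : complex.Re (u^*)%R = complex.Re u.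
Proof. by case: u. Qed.

Section Hilbert.
Variables (R : realType) (H : hilbertType R).
Implicit Types x y z : H.

Definition rdot x y : R := complex.Re (hdot x y).

Lemma rdotDl x y z : rdot (x + y) z = rdot x z + rdot y z.
Proof. by rewrite /rdot linearDl ReD. Qed.

Lemma rdotC x y : rdot x y = rdot y x.
Proof. by rewrite /rdot hermC expr0 mul1r Re_conj. Qed.

Lemma rdotDr x y z : rdot z (x + y) = rdot z x + rdot z y.
Proof. by rewrite rdotC rdotDl !(rdotC z). Qed.

Lemma rdotZl (k : R) x y : rdot (k%:C *: x) y = k * rdot x y.
Proof. by rewrite /rdot linearZl_LR ReM_real. Qed.

Lemma rdotZr (k : R) x y : rdot x (k%:C *: y) = k * rdot x y.
Proof. by rewrite rdotC rdotZl rdotC. Qed.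

Lemma rdot0r x : rdot x 0 = 0.
Proof. by apply: (addIr (rdot x 0)); rewrite -rdotDr !add0r. Qed.

Lemma rdotNl x y : rdot (- x) y = - rdot x y.
Proof. by rewrite -scaleN1r -(rmorphN1 (real_complex R)) rdotZl mulN1r. Qed.

Lemma rdotNr x y : rdot x (- y) = - rdot x y.
Proof. by rewrite rdotC rdotNl rdotC. Qed.

Lemma rdotxx x : rdot x x = `‖x‖ ^+ 2.
Proof. by rewrite /rdot hdot_norm rnormE -rmorphXn. Qed.

Lemma rnorm2D x y : `‖x + y‖ ^+ 2 = `‖x‖ ^+ 2 + `‖y‖ ^+ 2 + 2 * rdot x y.
Proof. by rewrite -!rdotxx rdotDl !rdotDr (rdotC y x); ring. Qed.

Lemma rnorm2B x y : `‖x - y‖ ^+ 2 = `‖x‖ ^+ 2 + `‖y‖ ^+ 2 - 2 * rdot x y.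
Proof. by rewrite rnorm2D rnormN rdotNr mulrN. Qed.

(** Cauchy-Schwarz, by expanding the squared norm of [|y| x - |x| y]. *)
Lemma rdot_le x y : rdot x y <= `‖x‖ * `‖y‖.
Proof.
have := rnorm_ge0 x; rewrite le_eqVlt => /predU1P[/esym x0|x0].
  by rewrite x0 mul0r (rnorm0_eq0 x0) rdotC rdot0r.
have := rnorm_ge0 y; rewrite le_eqVlt => /predU1P[/esym y0|y0].
  by rewrite y0 mulr0 (rnorm0_eq0 y0) rdot0r.
have := sqr_ge0 `‖`‖y‖%:C *: x - `‖x‖%:C *: y‖.
rewrite rnorm2B !rnormZR rdotZl rdotZr !ger0_norm ?rnorm_ge0//.
move: x0 y0; move: `‖x‖ `‖y‖ (rdot x y) => s t d s0 t0 h.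
have st0 : 0 < s * t by rewrite mulr_gt0.
by rewrite -(ler_pM2l st0); lra.
Qed.

End Hilbert.

(** * Isometry of faithful representations *)

Section Representation.
Variables (R : realType) (A : cstarType R) (H : hilbertType R).
Variable pi : A -> H -> H.
Hypothesis pirep : representation pi.
Implicit Types (a b c : A) (x y : H).

Lemma rep_lin a : linear (pi a).
Proof. by have [/(_ a)[]] := pirep. Qed.

Lemma rep_linl x : linear (pi^~ x).
Proof. by have [_ pl _ _] := pirep; move=> k a b; exact: pl. Qed.

Lemma repM a b x : pi (a ⋅ b) x = pi a (pi b x).
Proof. by have [_ _ pM _] := pirep. Qed.

Lemma rdot_rep a x y : rdot (pi a x) y = rdot x (pi a^✶ y).
Proof. by have [_ _ _ ps] := pirep; rewrite /rdot ps. Qed.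

(** Since [1 - b^✶ b = (1 - c)^2], the difference [|x|^2 - |pi b x|^2] equals [|x - pi c x|^2]. *)
Lemma rep_rnorm a x : `‖pi a x‖ <= `‖a‖ * `‖x‖.
Proof.
have small b : `‖b‖ <= 1 -> `‖pi b x‖ <= `‖x‖.
  move=> b1; have [||c [csa _ cE _]] := @cstar_sqrt R A (b^✶ ⋅ b).
  - by rewrite starM starK.
  - by rewrite rnorm_star_mul expr_le1// rnorm_ge0.
  rewrite -(@ler_pXn2r _ 2)// ?nnegrE ?rnorm_ge0// -[leLHS]rdotxx.
  rewrite rdot_rep -repM -cE (linmapB (rep_linl x)) (linmapD (rep_linl x)).
  rewrite repM rdotDr rdotNr rdotDr -{3}csa -rdot_rep rdotxx.
  by have := sqr_ge0 `‖x - pi c x‖; rewrite rnorm2B; lra.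
have := rnorm_ge0 a; rewrite le_eqVlt => /predU1P[/esym|] a0.
  by rewrite (rnorm0_eq0 a0) (linmap0 (rep_linl x)) !rnorm0 mul0r.
rewrite -ler_pdivrMl// -[_^-1]ger0_norm ?invr_ge0 ?(ltW a0)// -rnormZR.
rewrite -(linmapZ (rep_linl x)); apply: small.
by rewrite rnormZR ger0_norm ?invr_ge0 ?(ltW a0)// mulVf ?gt_eqF.
Qed.

Lemma rep_rnorm_star (C : R) a : 0 <= C ->
  (forall x, `‖pi a x‖ <= C * `‖x‖) -> forall x, `‖pi a^✶ x‖ <= C * `‖x‖.
Proof.
move=> C0 aC x; have := rnorm_ge0 (pi a^✶ x).
rewrite le_eqVlt => /predU1P[<-|s0]; first by rewrite mulr_ge0// rnorm_ge0.
rewrite -(ler_pM2r s0) -expr2 -rdotxx rdot_rep starK.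
apply: le_trans (rdot_le _ _) _; rewrite (mulrC C) -mulrA.
by rewrite ler_wpM2l// rnorm_ge0.
Qed.

Section Faithful.
Hypothesis pifaithful : faithful pi.

Lemma faithful0 a : (forall x, pi a x = 0) -> a = 0.
Proof.
move=> a0; apply: pifaithful; apply/funext => x.
by rewrite a0 (linmap0 (rep_linl x)).
Qed.

(* [1 - c] and [1 - w] have the same square, and are positive operators. *)
Lemma faithful_sqrt_unique c w : c^✶ = c -> w^✶ = w -> w ⋅ c = c ⋅ w ->
  (forall x, `‖pi c x‖ <= `‖x‖) -> (forall x, `‖pi w x‖ <= `‖x‖) ->
  c + c - c ⋅ c = w + w - w ⋅ w -> c = w.
Proof.
move=> csa wsa wc c1 w1 E; apply/esym/subr0_eq/faithful0 => x.
set d := w - c.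
have dE : (c + w) ⋅ d = d + d.
  rewrite /d cmulBr !cmulDl wc.
  have -> : w ⋅ w = w + w - (c + c - c ⋅ c) by rewrite E; zmod.
  zmod.
have dd0 : pi d (pi d x) = 0.
  set z := pi d x.
  have zE : pi c z + pi w z = z + z.
    by rewrite -(linmapD (rep_linl z)) -repM dE (linmapD (rep_linl x)).
  (* Contractivity bounds each term by [|z|^2], so both are equalities, which forces
     [pi c z = z = pi w z]. *)
  have zz : rdot z (pi c z) + rdot z (pi w z) = 2 * `‖z‖ ^+ 2.
    by rewrite -rdotDr zE rdotDr rdotxx; lra.
  have sqc : `‖pi c z‖ ^+ 2 <= `‖z‖ ^+ 2 by rewrite lerXn2r ?nnegrE ?rnorm_ge0.
  have sqw : `‖pi w z‖ ^+ 2 <= `‖z‖ ^+ 2 by rewrite lerXn2r ?nnegrE ?rnorm_ge0.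
  have := rnorm2B z (pi c z); have := rnorm2B z (pi w z).
  have := sqr_ge0 `‖z - pi c z‖; have := sqr_ge0 `‖z - pi w z‖ => gw gc ew ec.
  have /eqP : `‖z - pi c z‖ ^+ 2 = 0 by lra.
  have /eqP : `‖z - pi w z‖ ^+ 2 = 0 by lra.
  rewrite !sqrf_eq0 => /eqP/rnorm0_eq0/subr0_eq wz /eqP/rnorm0_eq0/subr0_eq cz.
  by rewrite (linmapB (rep_linl z)) -wz -cz subrr.
apply/rnorm0_eq0/eqP; rewrite -sqrf_eq0 -rdotxx rdot_rep starB csa wsa dd0.
by rewrite rdot0r.
Qed.

(** If [C < |a|], rescale [a] to [b] so that [w = 2 b^2] has norm above 1 while [pi w] is
    contractive. Then [w] and the [c2] given by [cstar_sqrt] for [y^2] solve the same quadratic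
    equation, so uniqueness gives [w = c2], contradicting [|c2| <= 1]. *)
Lemma faithful_rnorm_le_sa (C : R) a : a^✶ = a -> 0 <= C ->
  (forall x, `‖pi a x‖ <= C * `‖x‖) -> `‖a‖ <= C.
Proof.
move=> asa C0 aC; rewrite leNgt; apply/negP => Ca.
have a0 : 0 < `‖a‖ by exact: le_lt_trans Ca.
(* After division by [k], the number [1 / 2] separates [C ^+ 2] from the square of the norm of
   [a]. *)
pose k := `‖a‖ ^+ 2 + C ^+ 2.
have k0 : 0 < k by rewrite ltr_pwDl ?exprn_gt0// exprn_ge0.
have [r r0 rk] : exists2 r : R, 0 <= r & r ^+ 2 = k^-1.
  by exists (Num.sqrt k^-1); rewrite ?sqrtr_ge0// sqr_sqrtr// invr_ge0 ltW.
have CCa : C ^+ 2 < `‖a‖ ^+ 2 by rewrite ltr_pXn2r ?nnegrE ?(ltW a0).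
pose b := r%:C *: a.
have bsa : b^✶ = b by rewrite starZ asa conjC_real_complex.
have bb : `‖b‖ ^+ 2 = `‖a‖ ^+ 2 / k.
  by rewrite rnormZR ger0_norm// exprMn rk mulrC.
have b1 : `‖b ⋅ b‖ <= 1.
  by rewrite rnorm_sa// bb ler_pdivrMr// mul1r /k lerDl exprn_ge0.
have [|c [csa _ cE cc]] := cstar_sqrt _ b1; first by rewrite starM bsa.
have bc : b ⋅ c = c ⋅ b by apply: cc; rewrite cmulA.
pose w := b ⋅ b + b ⋅ b; pose y := (b - b ⋅ c) + (b - b ⋅ c).
have wsa : w^✶ = w by rewrite starD starM bsa.
have yy : y ⋅ y = w + w - w ⋅ w by exact: sin2_sqr.
have y1 : `‖y‖ <= 1 by exact: rnorm_sin2_le1.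
have [||c2 [c2sa c21 c2E c2c]] := @cstar_sqrt R A (y ⋅ y).
- by rewrite yy starB starD starM wsa.
- apply: le_trans (rnormM _ _) _; rewrite -[leRHS]mul1r.
  by apply: ler_pM => //; exact: rnorm_ge0.
have wle x : `‖pi w x‖ <= `‖x‖.
  have bx z : `‖pi b z‖ <= r * (C * `‖z‖).
    rewrite (linmapZ (rep_linl z)) rnormZR ger0_norm//.
    exact: ler_wpM2l.
  rewrite (linmapD (rep_linl x)) rnorm_dbl repM.
  have : `‖pi b (pi b x)‖ <= C ^+ 2 / k * `‖x‖.
    apply: le_trans (bx _) _; rewrite -rk.
    have -> : C ^+ 2 * r ^+ 2 * `‖x‖ =
      r * (C * (r * (C * `‖x‖))) by ring.
    by rewrite ler_wpM2l// ler_wpM2l.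
  have : C ^+ 2 / k <= 1 / 2.
    by rewrite ler_pdivrMr// /k; lra.
  by move=> /(ler_wpM2r (rnorm_ge0 x)); lra.
have c2w : c2 = w.
  apply: faithful_sqrt_unique => //.
  - by apply: c2c; rewrite yy cmulBr cmulBl cmulDr cmulDl cmulA.
  - move=> x; apply: le_trans (rep_rnorm _ _) _.
    by rewrite -[leRHS]mul1r ler_wpM2r// rnorm_ge0.
  - by rewrite c2E yy.
move: c21; rewrite c2w rnorm_dbl rnorm_sa// bb.
rewrite -mulrDl ler_pdivrMr// /k; lra.
Qed.

Lemma faithful_rnorm_le (C : R) a : 0 <= C ->
  (forall x, `‖pi a x‖ <= C * `‖x‖) -> `‖a‖ <= C.
Proof.
move=> C0 aC; rewrite -(@ler_pXn2r _ 2)// ?nnegrE ?rnorm_ge0//.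
rewrite -rnorm_star_mul; apply: faithful_rnorm_le_sa.
- by rewrite starM starK.
- by rewrite exprn_ge0.
move=> x; rewrite repM; apply: le_trans (rep_rnorm_star C0 aC _) _.
by rewrite expr2 -mulrA ler_wpM2l.
Qed.

End Faithful.
End Representation.

(** * Dense spans and roots of unity *)

Section LinearSpan.
Variable K : pzRingType.

Inductive lspan (V : lmodType K) (X : set V) : set V :=
| lspan0 : lspan X 0
| lspan_cons k x v : X x -> lspan X v -> lspan X (k *: x + v).

Lemma subset_lspan (V : lmodType K) (X : set V) : X `<=` lspan X.
Proof.
by move=> x Xx; rewrite -[x]scale1r -[_ *: x]addr0; apply/lspan_cons/lspan0.
Qed.

Lemma lspanD (V : lmodType K) (X : set V) u v :
  lspan X u -> lspan X v -> lspan X (u + v).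
Proof.
elim=> [|k x w Xx _ IH] Xv; first by rewrite add0r.
by rewrite -addrA; apply: lspan_cons => //; exact: IH.
Qed.

Lemma lspan_linmap (U V : lmodType K) (h : U -> V) (X : set U) (Y : set V) u :
  linear h -> (forall x, X x -> lspan Y (h x)) -> lspan X u -> lspan Y (h u).
Proof.
move=> hl XY; elim=> [|k x w Xx _ IH].
  by rewrite (linmap0 hl); exact: lspan0.
rewrite hl; apply: lspanD IH.
elim: (XY _ Xx) => [|l y v Yy _ IH]; first by rewrite scaler0; exact: lspan0.
by rewrite scalerDr scalerA; apply: lspan_cons.
Qed.

Lemma lspan_mono (V : lmodType K) (X Y : set V) :
  X `<=` Y -> lspan X `<=` lspan Y.
Proof.
move=> XY v; apply: (@lspan_linmap _ _ id) => // x /XY; exact: subset_lspan.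
Qed.

Lemma lspanZ (V : lmodType K) (X : set V) k u : lspan X u -> lspan X (k *: u).
Proof.
elim=> [|l x v Xx _ IH]; first by rewrite scaler0; exact: lspan0.
by rewrite scalerDr scalerA; apply: lspan_cons.
Qed.

End LinearSpan.

Section CStarSpan.
Variables (R : realType) (A : cstarType R).
Implicit Types X Y Z : set A.

Lemma lspanM X Y Z : (forall x y, X x -> Y y -> lspan Z (x ⋅ y)) ->
  forall u v, lspan X u -> lspan Y v -> lspan Z (u ⋅ v).
Proof.
move=> XYZ u v Xu Yv; apply: (lspan_linmap (cmul_linl v) _ Xu) => x Xx.
by apply: (lspan_linmap (cmul_linr x) _ Yv) => y; exact: XYZ.
Qed.

Lemma lspan_star X Y : (forall x, X x -> lspan Y x^✶) ->
  forall u, lspan X u -> lspan Y u^✶.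
Proof.
move=> XY u; elim=> [|k x v Xx _ IH]; first by rewrite star0; exact: lspan0.
by rewrite star_antilinear; apply: lspanD IH; apply/lspanZ/XY.
Qed.

Lemma closed_star_subalgebra_adherent (S : set A) : S 0 ->
  (forall (k : R[i]) a b, S a -> S b -> S (k *: a + b)) ->
  (forall a b, S a -> S b -> S (a ⋅ b)) -> (forall a, S a -> S a^✶) ->
  closed_star_subalgebra (adherent S).
Proof.
move=> S0 Sl SM Ss; split; first exact: closed_adherent.
- exact: subset_adherent.
- move=> k a b Sa Sb e e0; pose K := complex.Re `|k|.
  have K0 : 0 <= K by rewrite -ler0c RRe_real// ger0_real.
  have d0 : 0 < e / (K + 1) by rewrite divr_gt0//; lra.
  have [a' Sa' aa'] := Sa _ d0; have [b' Sb' bb'] := Sb _ d0.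
  exists (k *: a' + b'); first exact: Sl.
  have -> : k *: a + b - (k *: a' + b') = k *: (a - a') + (b - b').
    by rewrite scalerBr; zmod.
  apply: le_trans (ler_rnormD _ _) _; rewrite rnormZ -/K.
  have -> : e = K * (e / (K + 1)) + e / (K + 1).
    by field; apply: lt0r_neq0; lra.
  by apply: lerD => //; exact: ler_wpM2l.
- move=> a b Sa Sb e e0.
  (* [b'] is chosen first because the tolerance for [a'] depends on its norm; adding 1 keeps the
     denominators positive. *)
  have [b' Sb' bb'] : exists2 b', S b' & `‖b - b'‖ <= e / 2 / (`‖a‖ + 1).
    by apply: Sb; rewrite !divr_gt0//; have := rnorm_ge0 a; lra.
  have [a' Sa' aa'] : exists2 a', S a' & `‖a - a'‖ <= e / 2 / (`‖b'‖ + 1).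
    by apply: Sa; rewrite !divr_gt0//; have := rnorm_ge0 b'; lra.
  exists (a' ⋅ b'); first exact: SM.
  have -> : a ⋅ b - a' ⋅ b' = a ⋅ (b - b') + (a - a') ⋅ b'.
    by rewrite cmulBr cmulBl; zmod.
  have half (s t : R) : 0 <= s -> t <= e / 2 / (s + 1) -> s * t <= e / 2.
    move=> s0 ts; apply: le_trans (ler_wpM2l s0 ts) _.
    rewrite mulrCA -[leRHS]mulr1 ler_wpM2l ?divr_ge0 ?(ltW e0)//.
    by rewrite ler_pdivrMr; lra.
  apply: le_trans (ler_rnormD _ _) _; rewrite [e]splitr; apply: lerD.
    by apply: le_trans (rnormM _ _) _; apply: half; rewrite ?rnorm_ge0.
  by apply: le_trans (rnormM _ _) _; rewrite mulrC; apply: half;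
    rewrite ?rnorm_ge0.
- move=> a Sa e e0; have [b Sb ab] := Sa _ e0.
  by exists b^✶; [exact: Ss|rewrite -starB rnorm_star].
Qed.

(** The common source of the density statements below: the span is a *-algebra, and its closure
    contains the generators. *)
Lemma generates_adherent_lspan (G X : set A) : generates G ->
  G `<=` adherent (lspan X) ->
  (forall x y, X x -> X y -> lspan X (x ⋅ y)) ->
  (forall x, X x -> lspan X x^✶) ->
  forall a, adherent (lspan X) a.
Proof.
move=> gG GX XM Xs a; rewrite (gG (adherent (lspan X)))//.
apply: closed_star_subalgebra_adherent; first exact: lspan0.
- by move=> k x y Xx Xy; apply: lspanD => //; exact: lspanZ.
- exact: lspanM.
- exact: lspan_star.
Qed.

(** This is [a ^ (2 ^ n)]. Repeated squaring requires no unit, and by the C*-identity it is exact on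
    norms of self-adjoint elements. *)
Definition pow2 n (a : A) := iter n (fun x => x ⋅ x) a.

Lemma rnorm_pow2_le n a : `‖pow2 n a‖ <= `‖a‖ ^+ (2 ^ n).
Proof.
elim: n => [|n IH]; first by rewrite expr1.
rewrite /= expnSr exprM expr2; apply: le_trans (rnormM _ _) _.
by apply: ler_pM => //; exact: rnorm_ge0.
Qed.

Lemma star_pow2 n a : a^✶ = a -> (pow2 n a)^✶ = pow2 n a.
Proof. by move=> asa; elim: n => //= n IH; rewrite starM IH. Qed.

Lemma rnorm_pow2 n a : a^✶ = a -> `‖pow2 n a‖ = `‖a‖ ^+ (2 ^ n).
Proof.
move=> asa; elim: n => [|n IH]; first by rewrite expr1.
by rewrite /= rnorm_sa ?star_pow2// IH expnSr exprM.
Qed.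

End CStarSpan.

Lemma generates_star_hom_eq (R : realType) (A B : cstarType R) (G : set A)
    (g h : A -> B) : generates G -> star_hom g -> star_hom h ->
  (forall x, G x -> g x = h x) -> forall x, g x = h x.
Proof.
move=> gG gh hh gE x; pose S := [set x | g x = h x].
have [gl gM gs] := gh; have [hl hM hs] := hh.
suff /(gG S)/(_ gE) ST : closed_star_subalgebra S.
  by have : S x by rewrite ST.
split; rewrite /S /=.
- apply: closed_rnormP => y Sy; apply/subr0_eq/rnorm_approx0 => e e0.
  have [z /= gz yz] := Sy (e / 2) ltac:(by rewrite divr_gt0).
  have -> : g y - h y = g (y - z) - h (y - z).
    by rewrite (linmapB gl) (linmapB hl) gz; zmod.
  rewrite [e]splitr; apply: le_trans (ler_rnormD _ _) _; rewrite rnormN.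
  by apply: lerD; apply: le_trans (star_hom_rnorm _ _) yz.
- by rewrite (linmap0 gl) (linmap0 hl).
- by move=> k a b ga gb; rewrite gl hl ga gb.
- by move=> a b ga gb; rewrite gM hM ga gb.
- by move=> a ga; rewrite gs hs ga.
Qed.

(** If [t = a / b] exceeded 1, Bernoulli's inequality squared once would make [t ^+ (2 ^ n.+1)] grow
    at least like a multiple of [(2 ^ n) ^ 2], against a bound linear in [2 ^ n]. *)
Lemma le_of_exp_le (R : realType) (a b C : R) : 0 <= a -> 0 <= b -> 0 <= C ->
  (forall n, a ^+ (2 ^ n) <= C * (2 ^ n)%:R * b ^+ (2 ^ n)) -> a <= b.
Proof.
move=> a0; rewrite le_eqVlt => /predU1P[<-|b0] C0 abC.
  by have := abC 0; rewrite expn0 expr1 expr1 mulr0.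
rewrite leNgt; apply/negP => ba; pose t := a / b.
have tb n : t ^+ (2 ^ n) <= C * (2 ^ n)%:R.
  by rewrite /t exprMn exprVn ler_pdivrMr ?exprn_gt0.
have t1 : 1 < t by rewrite /t ltr_pdivlMr ?mul1r.
have t0 : 0 <= t by rewrite ltW// (lt_trans ltr01 t1).
pose d := t - 1; have d0 : 0 < d by rewrite subr_gt0.
have bern n : n%:R * d <= t ^+ n.
  suff : 1 + n%:R * d <= t ^+ n by apply: le_trans; rewrite lerDr.
  elim: n => [|n IH]; first by rewrite mul0r addr0 expr0.
  have n0 : 0 <= n%:R :> R by [].
  have nd0 : 0 <= n%:R * d by rewrite mulr_ge0 ?(ltW d0).
  rewrite exprS -natr1; have -> : t = 1 + d by rewrite /d; ring.
  have := ler_wpM2l t0 IH.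
  have -> : t = 1 + d by rewrite /d; ring.
  have : 0 <= d * (n%:R * d) by rewrite mulr_ge0 ?(ltW d0).
  by nra.
have key n : (2 ^ n)%:R * d ^+ 2 <= 2 * C.
  have p0 : 0 < (2 ^ n)%:R :> R by rewrite ltr0n expn_gt0.
  rewrite -(ler_pM2l p0) -subr_ge0.
  have := tb n.+1; rewrite expnSr exprM natrM.
  have : ((2 ^ n)%:R * d) ^+ 2 <= (t ^+ (2 ^ n)) ^+ 2.
    rewrite [X in X <= _]expr2 [X in _ <= X]expr2.
    by apply: ler_pM (bern _) (bern _); rewrite mulr_ge0 ?(ltW d0).
  rewrite exprMn; lra.
have [n nC] : exists n : nat, 2 * C / d ^+ 2 < n%:R.
  exists (Num.bound (2 * C / d ^+ 2)).
  by apply: archi_boundP; rewrite divr_ge0 ?mulr_ge0 ?exprn_ge0 ?(ltW d0).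
have := key n; rewrite -ler_pdivlMr ?exprn_gt0// leNgt => /negP; apply.
by apply: lt_le_trans nC _; rewrite ler_nat ltnW// ltn_expl.
Qed.

(** As [n] is invertible, [X^n - 1] is separable and has [n] distinct roots; such a group of roots
    of unity contains a primitive one. *)
Lemma prim_root_exists (F : closedFieldType) (n : nat) :
  n%:R != 0 :> F -> exists z : F, n.-primitive_root z.
Proof.
move=> nF; have n_gt0 : (0 < n)%N by case: n nF => //; rewrite eqxx.
have [r Dp] := closed_field_poly_normal ('X^n - 1 : {poly F}).
rewrite (monicP _) ?monicXnsubC// scale1r in Dp.
have rn1 : all n.-unity_root r.
  by apply/allP => z; rewrite -root_prod_XsubC -Dp.
have sz_r : (n < (size r).+1)%N.
  by rewrite -(size_prod_XsubC r id) -Dp size_XnsubC.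
have [|z _ zP] := hasP (has_prim_root n_gt0 rn1 _ sz_r); last by exists z.
by rewrite -separable_prod_XsubC -Dp separable_Xn_sub_1.
Qed.

(** Character orthogonality on the cyclic group of order [n]; it isolates the homogeneous
    components. *)
Lemma prim_root_sum (F : fieldType) (n : nat) (z : F) (d : nat) :
  n.-primitive_root z ->
  \sum_(i < n) z ^+ (i * d) = if (n %| d)%N then n%:R else 0.
Proof.
move=> zP; under eq_bigr do rewrite mulnC exprM.
case: ifPn => nd.
  have -> : z ^+ d = 1 by apply/eqP; rewrite -(prim_order_dvd zP).
  by under eq_bigr do rewrite expr1n; rewrite sumr_const card_ord.
have /mulfI : z ^+ d - 1 != 0 by rewrite subr_eq0 -(prim_order_dvd zP).
apply; rewrite -subrX1 mulr0 -exprM mulnC exprM (prim_expr_order zP).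
by rewrite expr1n subrr.
Qed.

(** * Path elements of a Cuntz-Krieger family *)

Section Projections.
Variables (R : realType) (A : cstarType R).

Lemma rnorm_projection_le1 (q : A) : is_projection q -> `‖q‖ <= 1.
Proof.
move=> [qq qs]; have := rnorm_sa qs; rewrite qq => q2.
by have := rnorm_ge0 q; have := sqr_ge0 (`‖q‖ - 1); nra.
Qed.

Lemma projection_partial_isometry (t : A) :
  is_partial_isometry t -> is_projection (t ⋅ t^✶).
Proof.
by move=> ttt; split; [rewrite cmulA ttt|rewrite starM starK].
Qed.

Variables (H : hilbertType R) (pi : A -> H -> H).
Hypotheses (pirep : representation pi) (pifaithful : faithful pi).

(* Compare [|q y|^2 <= |y|^2] with [|q y|^2 = \sum_i |e i y|^2] at
   [y = e j x]. *)
Lemma projection_sum_orthogonal (I : eqType) (r : seq I) (e : I -> A) :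
  uniq r -> (forall i, is_projection (e i)) ->
  is_projection (\sum_(i <- r) e i) ->
  {in r &, forall i j, i != j -> e i ⋅ e j = 0}.
Proof.
move=> ur eP qP i j ir jr ij; apply: (faithful0 pirep pifaithful) => x.
rewrite (repM pirep); set y := pi (e j) x; set q := \sum_(i <- r) e i in qP.
have sqE (f : A) : is_projection f -> `‖pi f y‖ ^+ 2 = rdot y (pi f y).
  by move=> [ff fs]; rewrite -rdotxx (rdot_rep pirep) fs -(repM pirep) ff.
have qy : `‖pi q y‖ ^+ 2 = \sum_(k <- r) `‖pi (e k) y‖ ^+ 2.
  rewrite sqE// (linmap_sum (rep_linl pirep y)).
  rewrite (big_morph (rdot y) (fun u v => rdotDr u v y) (rdot0r y)).
  by apply: eq_bigr => k _; rewrite sqE.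
have qle : `‖pi q y‖ ^+ 2 <= `‖y‖ ^+ 2.
  rewrite lerXn2r ?nnegrE ?rnorm_ge0//; apply: le_trans (rep_rnorm pirep _ _) _.
  by rewrite -[leRHS]mul1r ler_wpM2r ?rnorm_ge0// rnorm_projection_le1.
have ejy : pi (e j) y = y by rewrite -(repM pirep); case: (eP j) => ->.
move: qle; rewrite qy (bigD1_seq j)//= ejy big_mkcond (bigD1_seq i)//= ij.
set S := \sum_(k <- r | _) _ => qle; have : 0 <= S.
  by apply: sumr_ge0 => k _; case: ifP => // _; exact: sqr_ge0.
have := sqr_ge0 `‖pi (e i) y‖ => s0 S0; apply/rnorm0_eq0/eqP.
by rewrite -sqrf_eq0; apply/eqP; lra.
Qed.

End Projections.

Section CuntzKrieger.
Variables (R : realType) (Q : digraph) (A : cstarType R).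
Variables (s : edge Q -> A) (p : vertex Q -> A).
Hypotheses (Qfin : row_finite Q) (ck : ck_family s p).
Variables (H : hilbertType R) (pi : A -> H -> H).
Hypotheses (pirep : representation pi) (pifaithful : faithful pi).

Lemma ck_projection v : is_projection (p v).
Proof. by have [_ [pP _] _ _] := ck. Qed.

Lemma ck_orthogonal v w : v <> w -> p v ⋅ p w = 0.
Proof. by have [_ [_ po] _ _] := ck; exact: po. Qed.

Lemma ck_star_mul f : (s f)^✶ ⋅ s f = p (rng f).
Proof. by have [_ _ ss _] := ck. Qed.

Lemma ck_mul_rng f : s f ⋅ p (rng f) = s f.
Proof. by have [si _ _ _] := ck; rewrite -ck_star_mul cmulA si. Qed.

(** The vertex [src f] emits [f], so it is not a sink, and row-finiteness turns its defining sum
    into one over a list. *)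
Lemma ck_src f : exists r : seq (edge Q), [/\ uniq r,
  forall g, (g \in r) = (src g == src f) &
  p (src f) = \sum_(g <- r) (s g ⋅ (s g)^✶)].
Proof.
have [_ _ _ /(_ (src f)) sE] := ck.
exists (fset_set [set g | src g = src f]); split.
- exact: fset_uniq.
- move=> g; rewrite in_fset_set; last exact: Qfin.
  by apply/idP/eqP => [/set_mem|]//; exact: mem_set.
- rewrite sE; last by move=> /(_ f).
  by rewrite fsbig_finite//; exact: Qfin.
Qed.

(** The range projections of the edges leaving [src f] sum to a projection, hence are mutually
    orthogonal; only the summand of [f] survives. *)
Lemma ck_src_mul f : p (src f) ⋅ s f = s f.
Proof.
have [si _ _ _] := ck; have [r [ur rP pE]] := ck_src f.
have eP g : is_projection (s g ⋅ (s g)^✶) by exact: projection_partial_isometry.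
have qP : is_projection (\sum_(g <- r) (s g ⋅ (s g)^✶)).
  by rewrite -pE; exact: ck_projection.
have fr : f \in r by rewrite rP.
rewrite -[in LHS](si f) cmulA pE (linmap_sum (cmul_linl _)) (bigD1_seq f)//=.
rewrite big_seq_cond big1 ?addr0 => [|g /andP[gr gf]].
  by case: (eP f) => ->; rewrite si.
exact: (projection_sum_orthogonal pirep pifaithful ur eP qP).
Qed.

Lemma ck_edge_orthogonal f g : f != g -> (s f)^✶ ⋅ s g = 0.
Proof.
move=> fg; have [si _ _ _] := ck.
have [srcE|srcN] := eqVneq (src f) (src g).
  have [r [ur rP pE]] := ck_src f.
  have eP h : is_projection (s h ⋅ (s h)^✶).
    exact: projection_partial_isometry.
  have qP : is_projection (\sum_(g <- r) (s g ⋅ (s g)^✶)).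
    by rewrite -pE; exact: ck_projection.
  have ss h : (s h)^✶ ⋅ (s h ⋅ (s h)^✶) = (s h)^✶.
    by rewrite -[RHS](congr1 star (si h)) !starM starK cmulA.
  have -> : (s f)^✶ ⋅ s g =
      (s f)^✶ ⋅ (s f ⋅ (s f)^✶ ⋅ (s g ⋅ (s g)^✶)) ⋅ s g.
    by rewrite -[in LHS](ss f) -[in LHS](si g) !cmulA.
  rewrite (projection_sum_orthogonal pirep pifaithful ur eP qP) ?rP ?srcE//.
  by rewrite cmul0r cmul0l.
rewrite -(ck_src_mul f) -(ck_src_mul g) starM.
have [_ ->] := ck_projection (src f).
rewrite -cmulA (cmulA (p _)) ck_orthogonal ?cmul0l ?cmul0r//.
exact/eqP.
Qed.

(** The indices are the length, source and range of a path, with edges multiplied from source to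
    range. A relation on elements allows inversion to recover the first edge. *)
Inductive path_elt : nat -> vertex Q -> vertex Q -> A -> Prop :=
| path_elt0 v : path_elt 0 v v (p v)
| path_eltS k f u b : path_elt k (rng f) u b ->
    path_elt k.+1 (src f) u (s f ⋅ b).

Lemma path_elt_src k w u b : path_elt k w u b -> p w ⋅ b = b.
Proof.
case=> [v|k' f u' b' _]; first by case: (ck_projection v).
by rewrite cmulA ck_src_mul.
Qed.

Lemma path_elt_cat k m w u v a b :
  path_elt k w u a -> path_elt m u v b -> path_elt (k + m) w v (a ⋅ b).
Proof.
move=> ka; elim: ka b => [v' b mb|k' f u' b' _ IH b mb].
  by rewrite (path_elt_src mb).
by rewrite -cmulA; apply/path_eltS/IH.
Qed.

(** The shorter path is cancelled edge by edge from the front of the longer one: a mismatch gives 0,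
    otherwise the tail remains. *)
Lemma path_elt_star_mul k m w u w' u' a b :
  path_elt k w u a -> path_elt (k + m) w' u' b ->
  a^✶ ⋅ b = 0 \/ path_elt m u u' (a^✶ ⋅ b).
Proof.
move=> ka; elim: ka w' b => [v w' b mb|k' f v a' ka' IH w' b].
  have [_ ->] := ck_projection v.
  have [vw|/eqP vw] := eqVneq v w'.
    by right; rewrite vw (path_elt_src mb).
  by left; rewrite -(path_elt_src mb) cmulA ck_orthogonal// cmul0l.
rewrite addSn => mb; inversion mb as [|k1 g u1 b' mb' e1 e2 e3 e4]; subst.
have E : (s f ⋅ a')^✶ ⋅ (s g ⋅ b') = a'^✶ ⋅ ((s f)^✶ ⋅ s g) ⋅ b'.
  by rewrite starM !cmulA.
have [fg|fg] := eqVneq f g; last first.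
  by left; rewrite E ck_edge_orthogonal// cmul0r cmul0l.
subst g; suff -> : (s f ⋅ a')^✶ ⋅ (s f ⋅ b') = a'^✶ ⋅ b' by exact: IH mb'.
by rewrite E ck_star_mul -cmulA (path_elt_src mb').
Qed.

Lemma finite_path_rng k (W : set (vertex Q)) : finite_set W ->
  finite_set [set u | exists w b, W w /\ path_elt k w u b].
Proof.
elim: k W => [|k IH] W finW.
  by apply: sub_finite_set finW => u [w [b [Ww]]] P; inversion P; subst.
pose W' := \bigcup_(w in W) [set rng f | f in [set f | src f = w]].
have finW' : finite_set W'.
  by apply: bigcup_finite => // w _; apply: finite_image; exact: Qfin.
apply: sub_finite_set (IH _ finW') => u [w [b [Ww P]]].
inversion P as [|k' f u' b' P' e1 e2 e3 e4]; subst.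
by exists (rng f), b'; split=> //; exists (src f) => //; exists f.
Qed.

Lemma finite_path_rng_le k (W : set (vertex Q)) : finite_set W ->
  finite_set [set u | exists i w b, [/\ (i <= k)%N, W w & path_elt i w u b]].
Proof.
move=> finW; apply: (@sub_finite_set _ _ (\bigcup_(i in `I_k.+1)
    [set u | exists w b, W w /\ path_elt i w u b])).
  by move=> u [i [w [b [ik Ww P]]]]; exists i => //; exists w, b.
by apply: bigcup_finite => [|i _]; [exact: finite_II|exact: finite_path_rng].
Qed.

Definition path_monomial k l w w' (a : A) := exists u b b',
  [/\ path_elt k w u b, path_elt l w' u b' & a = b ⋅ b'^✶].

Lemma path_monomial_star k l w w' a :
  path_monomial k l w w' a -> path_monomial l k w' w a^✶.
Proof.
by move=> [u [b [b' [P P' ->]]]]; exists u, b', b; rewrite starM starK.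
Qed.

(** Truncated subtraction covers both cases at once: one of [k2 - l1] and [l1 - k2] is 0. The
    degree, first length minus second, is additive. *)
Lemma path_monomialM k1 l1 w1 w1' a1 k2 l2 w2 w2' a2 :
  path_monomial k1 l1 w1 w1' a1 -> path_monomial k2 l2 w2 w2' a2 ->
  a1 ⋅ a2 = 0 \/
  path_monomial (k1 + (k2 - l1)) (l2 + (l1 - k2)) w1 w2' (a1 ⋅ a2).
Proof.
move=> [u1 [b1 [b1' [P1 P1' ->]]]] [u2 [b2 [b2' [P2 P2' ->]]]].
have E : b1 ⋅ b1'^✶ ⋅ (b2 ⋅ b2'^✶) = b1 ⋅ (b1'^✶ ⋅ b2) ⋅ b2'^✶.
  by rewrite !cmulA.
have [lk|/ltnW kl] := leqP l1 k2.
  have -> : (l1 - k2 = 0)%N by apply/eqP.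
  rewrite addn0; have P2s := P2; rewrite -(subnKC lk) in P2s.
  have [z|P] := path_elt_star_mul P1' P2s.
    by left; rewrite E z cmul0r cmul0l.
  right; exists u2, (b1 ⋅ (b1'^✶ ⋅ b2)), b2'; split=> //.
  exact: path_elt_cat P.
have -> : (k2 - l1 = 0)%N by apply/eqP.
rewrite addn0; have P1s := P1'; rewrite -(subnKC kl) in P1s.
have [z|P] := path_elt_star_mul P2 P1s.
  by left; rewrite E -[_ ⋅ b2]starK starM starK z star0 cmul0r cmul0l.
right; exists u1, b1, (b2' ⋅ (b2^✶ ⋅ b1')); split=> //.
  exact: path_elt_cat P.
by rewrite E !starM starK !cmulA.
Qed.

Definition path_monomials : set A :=
  [set a | exists k l w w', path_monomial k l w w' a].

Lemma path_monomials_dense : generates (range s `|` range p) ->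
  forall a, adherent (lspan path_monomials) a.
Proof.
move=> gen; apply: (generates_adherent_lspan gen).
- move=> _ [[f _ <-]|[v _ <-]]; apply/subset_adherent/subset_lspan.
    exists 1%N, 0%N, (src f), (rng f), (rng f), (s f ⋅ p (rng f)), (p (rng f)).
    split; [exact/path_eltS/path_elt0|exact: path_elt0|].
    by have [pp ->] := ck_projection (rng f); rewrite -cmulA pp ck_mul_rng.
  exists 0%N, 0%N, v, v, v, (p v), (p v); split; [exact: path_elt0..|].
  by have [pp ->] := ck_projection v.
- move=> a b [k [l [w [w' Pa]]]] [k' [l' [v [v' Pb]]]].
  have [->|P] := path_monomialM Pa Pb; first exact: lspan0.
  by apply: subset_lspan; do 4 eexists; exact: P.
- move=> a [k [l [w [w' P]]]]; apply: subset_lspan.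
  by exists l, k, w', w; exact: path_monomial_star.
Qed.

End CuntzKrieger.

(** * Fourier coefficients in the crossed product *)

Section CrossedProduct.
Variables (R : realType) (G : groupType) (A F : cstarType R).
Variables (alpha : G -> A -> A) (j : A -> G -> F).
Hypotheses (alpha_act : cstar_action alpha) (hj : full_crossed_product alpha j).

Lemma action_star_hom t : star_hom (alpha t).
Proof. by have [] := alpha_act. Qed.

Lemma actionK t : cancel (alpha t) (alpha t^-1%g).
Proof.
by move=> a; have [_ a1 aM] := alpha_act; rewrite -aM mulVg a1.
Qed.

Lemma action_rnorm t a : `‖alpha t a‖ = `‖a‖.
Proof.
apply/eqP; rewrite eq_le (star_hom_rnorm (action_star_hom t))/=.
by rewrite -{1}[a](actionK t) (star_hom_rnorm (action_star_hom _)).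
Qed.

Lemma cp_lin t : linear (j^~ t).
Proof. by have [[]] := hj. Qed.

Lemma cpM a t b r : j a t ⋅ j b r = j (a ⋅ alpha t b) (t * r)%g.
Proof. by have [[_ jM _] _ _] := hj; exact: jM. Qed.

Lemma cp_star a t : (j a t)^✶ = j (alpha t^-1%g a^✶) t^-1%g.
Proof. by have [[_ _ js] _ _] := hj; exact: js. Qed.

Lemma cp1_star_hom : star_hom (j^~ 1%g).
Proof.
have [_ a1 _] := alpha_act; split; first exact: cp_lin.
  by move=> a b; rewrite cpM a1 mulg1.
by move=> a; rewrite cp_star invg1 a1.
Qed.

(** The C*-identity moves the estimate to the unit of [G], where [j] is a *-homomorphism on [A]. *)
Lemma cp_rnorm_le a t : `‖j a t‖ <= `‖a‖.
Proof.
have [_ _ alphaS] := action_star_hom t^-1%g.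
have [_ alphaM _] := action_star_hom t^-1%g.
rewrite -(@ler_pXn2r _ 2)// ?nnegrE ?rnorm_ge0// -!rnorm_star_mul cp_star cpM.
rewrite mulVg -alphaM; apply: le_trans (star_hom_rnorm cp1_star_hom _) _.
by rewrite action_rnorm.
Qed.

Definition cp_elements (T : set G) : set F :=
  [set y | exists2 t, T t & exists a, y = j a t].

Lemma cp_dense y : adherent (lspan (cp_elements setT)) y.
Proof.
have [_ gen _] := hj; apply: (generates_adherent_lspan gen).
- move=> _ [a [t ->]]; apply/subset_adherent/subset_lspan.
  by exists t; last exists a.
- move=> _ _ [t _ [a ->]] [r _ [b ->]]; apply: subset_lspan.
  by rewrite cpM; exists (t * r)%g => //; eexists.
- move=> _ [t _ [a ->]]; apply: subset_lspan; rewrite cp_star.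
  by exists t^-1%g => //; eexists.
Qed.

Lemma lspan_cp_finite (T : seq G) y : uniq T ->
  lspan (cp_elements [set` T]) y -> exists a, y = \sum_(t <- T) j (a t) t.
Proof.
move=> uT; elim=> [|k x v [t /= tT [b ->]] _ [a ->]].
  by exists (fun=> 0); rewrite big1// => t _; rewrite (linmap0 (cp_lin t)).
exists (fun r => if r == t then k *: b + a r else a r).
rewrite (bigD1_seq t)//= [in RHS](bigD1_seq t)//= eqxx cp_lin addrA.
congr (_ + _); apply: eq_bigr => r /negPf -> //.
Qed.

Lemma lspan_cp_support y : lspan (cp_elements setT) y ->
  exists T a, uniq T /\ y = \sum_(t <- T) j (a t) t.
Proof.
move=> Sy; suff [T uT /(lspan_cp_finite uT)[a ya]] :
    exists2 T : seq G, uniq T & lspan (cp_elements [set` T]) y.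
  by exists T, a.
elim: Sy => [|k x v [t _ [b ->]] _ [T uT Tv]].
  by exists [::] => //; exact: lspan0.
have sT r : r \in t :: T -> [set` undup (t :: T)] r by rewrite -mem_undup.
exists (undup (t :: T)); first exact: undup_uniq.
apply: lspan_cons.
  by exists t; [exact/sT/mem_head|exists b].
apply: lspan_mono Tv => _ [r rT [a ->]]; exists r; last by exists a.
by apply: sT; rewrite inE [r \in T]rT orbT.
Qed.

Variables (H K : hilbertType R) (pi : A -> H -> H) (J : G -> H -> K).
Variable Lam : F -> K -> K.
Hypotheses (pirep : representation pi) (pifaithful : faithful pi).
Hypotheses (J_ell2 : ell2_space J).
Hypothesis (Lam_reg : regular_representation alpha j pi J Lam).

Lemma regular_rep : representation Lam.
Proof. by have [] := Lam_reg. Qed.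

Lemma ell2_lin t : linear (J t).
Proof. by have [] := J_ell2. Qed.

Lemma ell2_rdot t x y : rdot (J t x) (J t y) = rdot x y.
Proof. by have [_ JJ _ _] := J_ell2; rewrite /rdot JJ. Qed.

Lemma ell2_orthogonal r t x y : r != t -> rdot (J r x) (J t y) = 0.
Proof. by move=> /eqP rt; have [_ _ J0 _] := J_ell2; rewrite /rdot J0. Qed.

Lemma ell2_rnorm t x : `‖J t x‖ = `‖x‖.
Proof.
by apply/eqP; rewrite -(@eqrXn2 _ 2)// ?rnorm_ge0// -!rdotxx ell2_rdot.
Qed.

Lemma regular_repE a t r x :
  Lam (j a t) (J r x) = J (t * r)%g (pi (alpha (t * r)^-1%g a) x).
Proof.
by have [_ [pit [lam [[_ _ pitE lamE] LamE]]]] := Lam_reg;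
  rewrite LamE lamE pitE.
Qed.

Lemma regular_rep_sum (T : seq G) (a : G -> A) r x :
  Lam (\sum_(t <- T) j (a t) t) (J r x) =
  \sum_(t <- T) J (t * r)%g (pi (alpha (t * r)^-1%g (a t)) x).
Proof.
rewrite (linmap_sum (rep_linl regular_rep _)).
by apply: eq_bigr => t _; rewrite regular_repE.
Qed.

Definition repker : set F := [set x | forall v, Lam x v = 0].

Lemma repkerD x y : repker x -> repker y -> repker (x + y).
Proof.
by move=> Kx Ky v; rewrite (linmapD (rep_linl regular_rep v)) Kx Ky addr0.
Qed.

Lemma repker0 : repker 0.
Proof. by move=> v; rewrite (linmap0 (rep_linl regular_rep v)). Qed.

Lemma repkerZ k x : repker x -> repker (k *: x).
Proof.
by move=> Kx v; rewrite (linmapZ (rep_linl regular_rep v)) Kx scaler0.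
Qed.

Lemma repker_sum (I : Type) (r : seq I) (P : pred I) (f : I -> F) :
  (forall i, P i -> repker (f i)) -> repker (\sum_(i <- r | P i) f i).
Proof. by move=> Kf; apply: big_ind => //; [exact: repker0|exact: repkerD]. Qed.

Lemma repkerMl x y : repker x -> repker (y ⋅ x).
Proof.
move=> Kx v; rewrite (repM regular_rep) Kx.
exact: (linmap0 (rep_lin regular_rep y)).
Qed.

Lemma repkerMr x y : repker x -> repker (x ⋅ y).
Proof. by move=> Kx v; rewrite (repM regular_rep). Qed.

Lemma repker_star x : repker x -> repker x^✶.
Proof.
move=> Kx v; apply/rnorm0_eq0/eqP; rewrite -sqrf_eq0 -rdotxx.
by rewrite (rdot_rep regular_rep) starK Kx rdot0r.
Qed.

(** The kernel is a self-adjoint ideal; this congruence reduces norm estimates for [y] to the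
    self-adjoint [y^✶ ⋅ y]. *)
Lemma repker_star_mul x y : repker x ->
  repker (y^✶ ⋅ y - (y - x)^✶ ⋅ (y - x)).
Proof.
move=> Kx.
have -> : y^✶ ⋅ y - (y - x)^✶ ⋅ (y - x) = y^✶ ⋅ x + x^✶ ⋅ (y - x).
  by rewrite starB !cmulBl !cmulBr; zmod.
by apply: repkerD; [exact: repkerMl|exact/repkerMr/repker_star].
Qed.

Lemma repker_pow2 n x y : repker x -> repker (pow2 n y - pow2 n (y - x)).
Proof.
move=> Kx; elim: n => [|n IH] /=.
  by have -> : y - (y - x) = x by zmod.
set u := pow2 n y in IH *; set v := pow2 n (y - x) in IH *.
have -> : u ⋅ u - v ⋅ v = u ⋅ (u - v) + (u - v) ⋅ v.
  by rewrite cmulBr cmulBl; zmod.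
by apply: repkerD; [exact: repkerMl|exact: repkerMr].
Qed.

(* The Fourier coefficients are contractive for the norm of the reduced crossed
   product. *)
Lemma fourier_rnorm_le (T : seq G) (a : G -> A) x t : uniq T -> t \in T ->
  repker x -> `‖a t‖ <= `‖\sum_(r <- T) j (a r) r - x‖.
Proof.
move=> uT tT Kx; set y := \sum_(r <- T) _.
rewrite -(action_rnorm t^-1%g).
apply: (faithful_rnorm_le pirep pifaithful); first exact: rnorm_ge0.
(* On a vector supported at the unit of [G], the coefficient at [t] appears as the component at [t],
   orthogonal to the others. *)
move=> v; have := rep_rnorm regular_rep (y - x) (J 1%g v).
rewrite ell2_rnorm; apply: le_trans.
rewrite (linmapB (rep_linl regular_rep _)) Kx subr0 regular_rep_sum.
under eq_bigr do rewrite mulg1.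
rewrite (bigD1_seq t)//=; set z := \sum_(_ <- _ | _) _.
rewrite -(@ler_pXn2r _ 2)// ?nnegrE ?rnorm_ge0// rnorm2D ell2_rnorm.
have -> : rdot (J t (pi (alpha t^-1%g (a t)) v)) z = 0.
  rewrite (big_morph (rdot _) (fun u w => rdotDr u w _) (rdot0r _)).
  by rewrite big1// => r rt; rewrite ell2_orthogonal// eq_sym.
by have := sqr_ge0 `‖z‖; lra.
Qed.

Lemma ell2_total (S : set K) : (forall x, adherent S x -> S x) -> S 0 ->
  (forall (k : R[i]) u v, S u -> S v -> S (k *: u + v)) ->
  (forall t x, S (J t x)) -> forall x, S x.
Proof.
move=> Scl S0 Sl SJ x; have [_ _ _ Jtot] := J_ell2.
by rewrite (Jtot S)//; exact: closed_rnormP.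
Qed.

Lemma ell2_orthogonal0 w : (forall t x, rdot w (J t x) <= 0) -> w = 0.
Proof.
move=> wJ; have wJ0 t x : rdot w (J t x) = 0.
  apply/eqP; rewrite eq_le wJ/= -oppr_le0 -rdotNr -(linmapN (ell2_lin t)).
  exact: wJ.
(* The form [rdot] is only real bilinear, whereas totality concerns complex subspaces; hence the
   quantification over all complex [k]. *)
have : forall v, forall k : R[i], rdot w (k *: v) = 0; last first.
  move=> /(_ w 1); rewrite scale1r rdotxx => /eqP.
  by rewrite sqrf_eq0 => /eqP/rnorm0_eq0.
apply: ell2_total => /=.
- move=> v Sv; suff le k : rdot w (k *: v) <= 0.
    move=> k; apply/eqP; rewrite eq_le le/= -oppr_le0 -rdotNr -scaleNr.
    exact: le.
  apply/ler_addgt0Pl => e e0; rewrite addr0.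
  pose c := `‖w‖ * complex.Re `|k| + 1.
  have k0 : 0 <= complex.Re `|k| by rewrite -ler0c RRe_real// ger0_real.
  have c0 : 0 < c by rewrite ltr_wpDl// mulr_ge0// rnorm_ge0.
  have [u Su vu] := Sv (e / c) ltac:(by rewrite divr_gt0).
  have -> : rdot w (k *: v) = rdot w (k *: (v - u)).
    by rewrite scalerBr rdotDr rdotNr Su subr0.
  apply: le_trans (rdot_le _ _) _; rewrite rnormZ mulrA.
  have wk0 : 0 <= `‖w‖ * complex.Re `|k| by rewrite mulr_ge0// rnorm_ge0.
  apply: le_trans (ler_wpM2l wk0 vu) _.
  rewrite mulrCA -[leRHS]mulr1 ler_wpM2l ?(ltW e0)//.
  by rewrite ler_pdivrMr// mul1r /c lerDl.
- by move=> k; rewrite scaler0 rdot0r.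
- by move=> l u v Su Sv k; rewrite scalerDr scalerA rdotDr Su Sv addr0.
- by move=> t x k; rewrite -(linmapZ (ell2_lin t)) wJ0.
Qed.

(* An endomorphism of the crossed product that acts on coefficients preserves
   the kernel, since this kernel consists of the elements all of whose Fourier
   coefficients vanish. *)
Lemma repker_coefficientwise (beta : A -> A) (B : F -> F) : star_hom beta ->
  star_hom B -> (forall a t, B (j a t) = j (beta a) t) ->
  forall x, repker x -> repker (B x).
Proof.
move=> hbeta hB Bj x Kx.
have BJ r v : Lam (B x) (J r v) = 0.
  apply: ell2_orthogonal0 => t w; apply/ler_addgt0Pl => e e0; rewrite addr0.
  pose c := `‖v‖ * `‖w‖; have c0 : 0 <= c by rewrite mulr_ge0 ?rnorm_ge0.
  have [d d0 dce] : exists2 d : R, 0 < d & e = d * (c + c + 1).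
    exists (e / (c + c + 1)); first by rewrite divr_gt0//; lra.
    by rewrite mulfVK// lt0r_neq0//; lra.
  have [y Sy xy] := cp_dense x d0.
  have [T [a [uT yE]]] := lspan_cp_support Sy.
  (* As [x] is in the kernel, an approximant [y] of it has small Fourier coefficients, and [beta]
     does not enlarge them. *)
  have ad r' : r' \in T -> `‖a r'‖ <= d.
    move=> r'T; apply: le_trans xy; rewrite rnormB_sym yE.
    exact: fourier_rnorm_le.
  have [Bl _ _] := hB; have ByE : B y = \sum_(t <- T) j (beta (a t)) t.
    by rewrite yE (linmap_sum Bl); apply: eq_bigr => t' _; rewrite Bj.
  rewrite -[x](subrK y) (linmapD Bl) (linmapD (rep_linl regular_rep _)) rdotDl.
  suff [h1 h2] : rdot (Lam (B (x - y)) (J r v)) (J t w) <= d * c /\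
      rdot (Lam (B y) (J r v)) (J t w) <= d * c by lra.
  split.
    apply: le_trans (rdot_le _ _) _; rewrite ell2_rnorm /c mulrA.
    rewrite ler_wpM2r ?rnorm_ge0//.
    apply: le_trans (rep_rnorm regular_rep _ _) _.
    rewrite ell2_rnorm ler_wpM2r ?rnorm_ge0//.
    exact: le_trans (star_hom_rnorm hB _) xy.
  rewrite ByE regular_rep_sum rdotC.
  rewrite (big_morph (rdot _) (fun u w => rdotDr u w _) (rdot0r _)).
  (* The coefficient at [t'] moves position [r] to [t' * r], so only [t' = t * r^-1] contributes at
     position [t]. *)
  have [tT|tT] := boolP ((t * r^-1)%g \in T); last first.
    rewrite big_seq big1 => [|t' t'T]; first exact: mulr_ge0 (ltW d0) c0.
    rewrite ell2_orthogonal//; apply: contra tT => /eqP ->.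
    by rewrite mulgK.
  rewrite (bigD1_seq (t * r^-1)%g)//= mulgVK ell2_rdot big1 ?addr0; last first.
    move=> t' tt'; rewrite ell2_orthogonal//; apply: contra tt' => /eqP ->.
    by rewrite mulgK.
  apply: le_trans (rdot_le _ _) _; rewrite /c mulrC mulrA.
  rewrite ler_wpM2r ?rnorm_ge0//; apply: le_trans (rep_rnorm pirep _ _) _.
  rewrite ler_wpM2r ?rnorm_ge0// action_rnorm.
  by apply: le_trans (star_hom_rnorm hbeta _) _; exact: ad.
apply: ell2_total => //=.
- move=> v Sv; apply: rnorm_approx0 => e e0.
  pose c := `‖B x‖ + 1; have c0 : 0 < c by rewrite ltr_wpDl// rnorm_ge0.
  have [u Su vu] := Sv (e / c) ltac:(by rewrite divr_gt0).
  rewrite -[Lam _ _]subr0 -Su -(linmapB (rep_lin regular_rep _)).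
  apply: le_trans (rep_rnorm regular_rep _ _) _.
  apply: le_trans (ler_wpM2l (rnorm_ge0 _) vu) _.
  rewrite mulrCA -[leRHS]mulr1 ler_wpM2l ?(ltW e0)//.
  by rewrite ler_pdivrMr// mul1r /c lerDl.
- exact: (linmap0 (rep_lin regular_rep _)).
- by move=> k u v Su Sv; rewrite (rep_lin regular_rep) Su Sv scaler0 addr0.
Qed.

End CrossedProduct.

(** * Crossed products of skew-product graph algebras *)

Lemma row_finite_skew_product (E : digraph) (G : groupType) (c : edge E -> G) :
  row_finite E -> row_finite (skew_product c).
Proof.
move=> hE [v g].
have := finite_image (fun f => (f, ((c f)^-1 * g)%g)) (hE v).
apply: sub_finite_set.
by move=> [f r] /= [<- <-]; exists f => //=; rewrite mulKg.
Qed.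

Section SkewProduct.
Variables (R : realType) (E : digraph) (G : groupType) (c : edge E -> G).
Let Q := skew_product c.
Variables (A : cstarType R) (s : edge Q -> A) (p : vertex Q -> A).
Hypotheses (hE : row_finite E) (hA : graph_cstar s p).
Variable gamma : G -> A -> A.
Hypothesis gamma_act : cstar_action gamma.
Hypothesis gamma_s : forall (t r : G) (f : edge E),
  gamma t (s (f, r)) = s (f, (r * t^-1)%g).
Hypothesis gamma_p : forall (t r : G) (v : vertex E),
  gamma t (p (v, r)) = p (v, (r * t^-1)%g).
Variables (F : cstarType R) (j : A -> G -> F).
Hypothesis hj : full_crossed_product gamma j.
Variables (H K : hilbertType R) (pi : A -> H -> H) (J : G -> H -> K).
Variable Lam : F -> K -> K.
Hypotheses (pirep : representation pi) (pifaithful : faithful pi).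
Hypotheses (J_ell2 : ell2_space J).
Hypothesis (Lam_reg : regular_representation gamma j pi J Lam).

Let Qfin : row_finite Q := row_finite_skew_product hE.
Let ck : ck_family s p.
Proof. by have [] := hA. Qed.

(** The translation of vertices underlying [gamma]; acting on the right, it commutes with the left
    multiplication by [c] in the source map. *)
Definition vshift (t : G) (v : vertex Q) : vertex Q := (v.1, (v.2 * t^-1)%g).

Lemma vshiftM t r v : vshift t (vshift r v) = vshift (t * r)%g v.
Proof. by rewrite /vshift /= -mulgA -invgM. Qed.

Lemma vshift1 v : vshift 1%g v = v.
Proof. by case: v => v g; rewrite /vshift /= invg1 mulg1. Qed.

Lemma vshiftK t v : vshift t^-1%g (vshift t v) = v.
Proof. by rewrite vshiftM mulVg vshift1. Qed.

Lemma vshiftVK t v : vshift t (vshift t^-1%g v) = v.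
Proof. by rewrite vshiftM mulgV vshift1. Qed.

Lemma path_elt_shift t k w u b : path_elt s p k w u b ->
  path_elt s p k (vshift t w) (vshift t u) (gamma t b).
Proof.
have [_ gM _] := action_star_hom gamma_act t.
elim=> [[v g]|k' [f r] u' b' _ IH]; first by rewrite gamma_p; exact: path_elt0.
rewrite gM gamma_s.
have -> : vshift t (@src Q (f, r)) = @src Q (f, (r * t^-1)%g).
  by rewrite /vshift /= mulgA.
exact: path_eltS.
Qed.

Lemma path_monomial_shift t k l w w' a : path_monomial s p k l w w' a ->
  path_monomial s p k l (vshift t w) (vshift t w') (gamma t a).
Proof.
have [_ gM gS] := action_star_hom gamma_act t.
move=> [u [b [b' [P P' ->]]]]; exists (vshift t u), (gamma t b), (gamma t b').
by rewrite gM gS; split=> //; exact: path_elt_shift.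
Qed.

(* With [a] the product of a path from [w] by the adjoint of a path from
   [vshift t w'], the element [j a t] behaves as a matrix unit from [w] to
   [w']. *)
Definition cp_monomial k l w w' t (y : F) :=
  exists2 a, path_monomial s p k l w (vshift t w') a & y = j a t.

Lemma cp_monomialM k1 l1 w1 w1' t1 y1 k2 l2 w2 w2' t2 y2 :
  cp_monomial k1 l1 w1 w1' t1 y1 -> cp_monomial k2 l2 w2 w2' t2 y2 ->
  y1 ⋅ y2 = 0 \/
  cp_monomial (k1 + (k2 - l1)) (l2 + (l1 - k2)) w1 w2' (t1 * t2)%g (y1 ⋅ y2).
Proof.
move=> [a1 P1 ->] [a2 P2 ->]; rewrite (cpM hj).
have := path_monomial_shift t1 P2; rewrite vshiftM => P2'.
have [->|P] := path_monomialM Qfin ck pirep pifaithful P1 P2'.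
  by left; rewrite (linmap0 (cp_lin hj _)).
by right; exists (a1 ⋅ gamma t1 a2).
Qed.

Lemma cp_monomial_star k l w w' t y :
  cp_monomial k l w w' t y -> cp_monomial l k w' w t^-1%g y^✶.
Proof.
move=> [a P ->]; rewrite (cp_star hj); exists (gamma t^-1%g a^✶) => //.
by have := path_monomial_shift t^-1%g (path_monomial_star P); rewrite vshiftK.
Qed.

Definition cp_monomials : set F :=
  [set y | exists k l w w' t, cp_monomial k l w w' t y].

Lemma cp_monomials_dense y : adherent (lspan cp_monomials) y.
Proof.
have [_ gen _] := hj; apply: (generates_adherent_lspan gen).
- move=> _ [a [t ->]] e e0; have [_ genA _] := hA.
  have [b Sb ab] := path_monomials_dense Qfin ck pirep pifaithful genA a e0.
  exists (j b t); last first.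
    rewrite -(linmapB (cp_lin hj t)).
    exact: le_trans (cp_rnorm_le gamma_act hj _ _) ab.
  apply: (lspan_linmap (cp_lin hj t) _ Sb) => x [k [l [w [w' P]]]].
  apply: subset_lspan; exists k, l, w, (vshift t^-1%g w'), t, x => //.
  by rewrite vshiftVK.
- move=> x z [k [l [w [w' [t Px]]]]] [k' [l' [v [v' [r Pz]]]]].
  have [->|P] := cp_monomialM Px Pz; first exact: lspan0.
  by apply: subset_lspan; do 5 eexists; exact: P.
- move=> x [k [l [w [w' [t P]]]]]; apply: subset_lspan.
  by do 5 eexists; exact: cp_monomial_star P.
Qed.

(** * Gauge automorphisms and norm estimates modulo the kernel *)

Let ker := repker Lam.

(** Multiplying the edge generators by [z] gives another Cuntz-Krieger family, so universality
    applies. *)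
Lemma gauge_automorphism (z : R[i]) : `|z| = 1 -> exists beta : A -> A,
  [/\ star_hom beta, forall f, beta (s f) = z *: s f &
      forall v, beta (p v) = p v].
Proof.
move=> z1; have [_ _ univ] := hA; apply: univ.
have zz : z * (z^*)%R = 1 by rewrite -normCK z1 expr1n.
have [si [pP po] ss sE] := ck; split=> //.
- move=> f; rewrite /is_partial_isometry starZ !(cmulZl, cmulZr) !scalerA.
  by rewrite si mulrAC zz mul1r.
- by move=> f; rewrite starZ cmulZl cmulZr scalerA mulrC zz scale1r.
- move=> v /sE ->; apply: eq_fsbigr => f _.
  by rewrite starZ cmulZl cmulZr scalerA zz scale1r.
Qed.

(** The gauge automorphism commutes with [gamma] on generators, hence everywhere, and extends to [F]
    coefficientwise. As [|z| = 1], the scalar on a monomial is [z] to its degree [k - l]. *)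
Lemma gauge_crossed_product (z : R[i]) : `|z| = 1 -> exists B : F -> F,
  [/\ star_hom B,
      forall k l w w' t y, cp_monomial k l w w' t y ->
        B y = (z ^+ k * (z^*)%R ^+ l) *: y &
      forall x, ker x -> ker (B x)].
Proof.
move=> z1; have [beta [hb bs bp]] := gauge_automorphism z1.
have [bl bM bS] := hb; have [_ genA _] := hA.
have comm t a : gamma t (beta a) = beta (gamma t a).
  have hg := action_star_hom gamma_act t; have [gl gM gS] := hg.
  apply: (generates_star_hom_eq genA (g := fun a => gamma t (beta a))
    (h := fun a => beta (gamma t a))).
  - split=> [k x y|x y|x]; first by rewrite bl gl.
      by rewrite bM gM.
    by rewrite bS gS.
  - split=> [k x y|x y|x]; first by rewrite gl bl.
      by rewrite gM bM.
    by rewrite gS bS.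
  - move=> _ [[[f r] _ <-]|[[v r] _ <-]].
      by rewrite bs gamma_s bs (linmapZ gl) gamma_s.
    by rewrite bp gamma_p bp.
have [_ _ univ] := hj.
have [B [hB Bj]] : exists B : F -> F,
    star_hom B /\ forall a t, B (j a t) = j (beta a) t.
  apply: (univ F (fun a t => j (beta a) t)); split.
  - by move=> t k a b; rewrite bl (cp_lin hj).
  - by move=> a t b r; rewrite (cpM hj) comm bM.
  - by move=> a t; rewrite (cp_star hj) -bS comm.
exists B; split=> //; last first.
  exact: (repker_coefficientwise gamma_act hj pirep pifaithful J_ell2 Lam_reg
    hb).
have bpath k w u b : path_elt s p k w u b -> beta b = z ^+ k *: b.
  elim=> [v|k' f u' b' _ IH]; first by rewrite bp expr0 scale1r.
  by rewrite bM bs IH cmulZl cmulZr scalerA exprS.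
move=> k l w w' t y [a [u [b [b' [P P' ->]]]] ->].
rewrite Bj bM bS (bpath _ _ _ _ P) (bpath _ _ _ _ P') starZ cmulZl cmulZr.
rewrite scalerA.
by rewrite rmorphXn (linmapZ (cp_lin hj t)).
Qed.

(* Degree 0 and sources in a finite set [W]: the coefficients in [G] of such
   monomials range over a finite set. *)
Definition core_monomials (W : set (vertex Q)) (n : nat) : set F :=
  [set y | exists k w w' t,
    [/\ (k <= n)%N, W w, W w' & cp_monomial k k w w' t y]].

(** The two paths of a monomial end at one vertex [u]. Shifting the second by [t^-1] makes it start
    in [W] and end at [v] with [v.2 = u.2 * t]. Both ends lie in the finite set [V], so
    [t = u.2^-1 * v.2] takes finitely many values. *)
Lemma core_support W n : finite_set W -> exists2 T : seq G, uniq T &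
  core_monomials W n `<=` cp_elements j [set` T].
Proof.
move=> finW; pose V := [set u | exists i w b,
  [/\ (i <= n)%N, W w & path_elt s p i w u b]].
have finV : finite_set V by exact: finite_path_rng_le.
pose D := [set (u.2^-1 * v.2)%g | u in V & v in V].
have finD : finite_set D by exact: finite_image2.
exists (enum_fset (fset_set D)); first exact: fset_uniq.
move=> y [k [w [w' [t [kn Ww Ww' [a Pa ->]]]]]].
exists t; last by exists a.
have [u [b [b' [P P' _]]]] := Pa; have := path_elt_shift t^-1%g P'.
rewrite vshiftK => P''; suff : t \in fset_set D by [].
rewrite in_fset_set//; apply: mem_set; exists u; first by exists k, w, b.
exists (vshift t^-1%g u); first by exists k, w', (gamma t^-1%g b').
by rewrite /= invgK mulKg.
Qed.

(** In degree 0 a nonzero product has both lengths equal to the maximum of [k] and [l], so powers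
    never leave the bound [n] or the set [W]. *)
Lemma core_monomialsM W n x y : core_monomials W n x -> core_monomials W n y ->
  lspan (core_monomials W n) (x ⋅ y).
Proof.
move=> [k [w [w' [t [kn Ww Ww' P]]]]] [l [v [v' [r [ln Wv Wv' P']]]]].
have [->|PP] := cp_monomialM P P'; first exact: lspan0.
have klE : (l + (k - l) = k + (l - k))%N by lia.
apply: subset_lspan; exists (k + (l - k))%N, w, v', (t * r)%g.
by split=> //; [lia|rewrite klE in PP].
Qed.

Lemma core_rnorm_le W n x y : finite_set W -> ker x -> y^✶ = y ->
  lspan (core_monomials W n) y -> `‖y‖ <= `‖y - x‖.
Proof.
move=> finW Kx ysa Sy; have [T uT TW] := core_support n finW.
apply: (@le_of_exp_le _ _ _ (size T)%:R); rewrite ?rnorm_ge0// => m.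
have Sm : lspan (core_monomials W n) (pow2 m y).
  by elim: m => //= m IH; apply: (lspanM _ IH IH); exact: core_monomialsM.
have [a yE] := lspan_cp_finite hj uT (lspan_mono TW Sm).
have Km := repker_pow2 Lam_reg m y Kx.
rewrite -rnorm_pow2// yE; apply: le_trans (ler_rnorm_sum _ _ _) _.
apply: (@le_trans _ _ ((size T)%:R * `‖y - x‖ ^+ (2 ^ m))).
  have -> : (size T)%:R * `‖y - x‖ ^+ (2 ^ m) =
      \sum_(t <- T) `‖y - x‖ ^+ (2 ^ m).
    by rewrite big_const_seq count_predT iter_addr_0 mulr_natl.
  rewrite big_seq [leRHS]big_seq; apply: ler_sum => t tT.
  apply: le_trans (cp_rnorm_le gamma_act hj _ _) _.
  have := fourier_rnorm_le gamma_act pirep pifaithful J_ell2 Lam_reg a uT tT Km.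
  by rewrite -yE subKr => /le_trans; apply; exact: rnorm_pow2_le.
rewrite ler_wpM2r ?exprn_ge0 ?rnorm_ge0// ler_peMr//.
by rewrite ler1n expn_gt0.
Qed.

(* Monomials of gauge degree [k - l = e - e'], stated without subtraction. *)
Definition homogeneous_monomials (e e' : nat) : set F :=
  [set y | exists k l w w' t, (k + e' = l + e)%N /\ cp_monomial k l w w' t y].

Lemma degree0_core y : lspan (homogeneous_monomials 0 0) y ->
  exists W n, finite_set W /\ lspan (core_monomials W n) y.
Proof.
elim=> [|a x v [k [l [w [w' [t [kl P]]]]]] _ [W [n [finW Sv]]]].
  by exists set0, 0%N; split; [exact: finite_set0|exact: lspan0].
exists ([set w; w'] `|` W), (maxn k n); split.
  by rewrite finite_setU; split=> //; exact: finite_set2.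
apply: lspan_cons.
  have {}kl : l = k by lia.
  subst l; exists k, w, w', t; split=> //; first exact: leq_maxl.
    by left; left.
  by left; right.
apply: lspan_mono Sv => z [k' [u [u' [r [kn Wu Wu' P']]]]].
exists k', u, u', r; split=> //; [|by right..].
by rewrite leq_max kn orbT.
Qed.

Lemma homogeneous_rnorm_le e e' x y : ker x ->
  lspan (homogeneous_monomials e e') y -> `‖y‖ <= `‖y - x‖.
Proof.
move=> Kx Sy.
have [W [n [finW Syy]]] : exists W n,
    finite_set W /\ lspan (core_monomials W n) (y^✶ ⋅ y).
  apply: degree0_core.
  have Ss : lspan (homogeneous_monomials e' e) y^✶.
    apply: (lspan_star _ Sy) => z [k [l [w [w' [t [kl P]]]]]].
    apply: subset_lspan; exists l, k, w', w, t^-1%g; split; first by lia.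
    exact: cp_monomial_star.
  apply: (lspanM _ Ss Sy).
  move=> u v [k [l [w [w' [t [kl P]]]]]] [k' [l' [z [z' [r [kl' P']]]]]].
  have [->|PP] := cp_monomialM P P'; first exact: lspan0.
  by apply: subset_lspan; do 5 eexists; split; [|exact: PP]; lia.
have Kyy : ker (y^✶ ⋅ y - (y - x)^✶ ⋅ (y - x)).
  exact: (repker_star_mul Lam_reg).
rewrite -(@ler_pXn2r _ 2)// ?nnegrE ?rnorm_ge0// -!rnorm_star_mul.
apply: le_trans (core_rnorm_le finW Kyy _ Syy) _; first by rewrite starM starK.
by rewrite subKr.
Qed.

Definition bounded_monomials (n : nat) : set F :=
  [set y | exists k l w w' t,
    [/\ (k <= n)%N, (l <= n)%N & cp_monomial k l w w' t y]].

Lemma cp_monomials_bounded y : lspan cp_monomials y ->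
  exists n, lspan (bounded_monomials n) y.
Proof.
elim=> [|a x v [k [l [w [w' [t P]]]]] _ [n Sv]].
  by exists 0%N; exact: lspan0.
exists (maxn (maxn k l) n); apply: lspan_cons.
  by exists k, l, w, w', t; split=> //; lia.
apply: lspan_mono Sv => z [k' [l' [u [u' [r [kn ln P']]]]]].
by exists k', l', u, u', r; split=> //; lia.
Qed.

Lemma bounded_monomials_pow2 n m y : lspan (bounded_monomials n) y ->
  lspan (bounded_monomials (2 ^ m * n)) (pow2 m y).
Proof.
move=> Sy; elim: m => [|m IH]; first by rewrite mul1n.
rewrite /=; apply: (lspanM _ IH IH).
move=> u v [k [l [w [w' [t [kn ln P]]]]]] [k' [l' [z [z' [r [kn' ln' P']]]]]].
have [->|PP] := cp_monomialM P P'; first exact: lspan0.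
apply: subset_lspan; do 5 eexists; split; [| |exact: PP].
  by rewrite expnSr; lia.
by rewrite expnSr; lia.
Qed.

(* A homogeneous component of [y ^ (2 ^ m)] is obtained by averaging over roots
   of unity, so its norm is at most that of [(y - x) ^ (2 ^ m)] modulo the
   kernel; there are only linearly many components. *)
Lemma bounded_rnorm_le n x y : ker x ->
  lspan (bounded_monomials n) y -> y^✶ = y -> `‖y‖ <= `‖y - x‖.
Proof.
move=> Kx Sy ysa.
apply: (@le_of_exp_le _ _ _ (2 * n + 1)%:R); rewrite ?rnorm_ge0// => m.
(* Degrees in [u] lie between [- N] and [N], so they are pairwise incongruent modulo
   [M = 2 N + 1]. *)
pose N := (2 ^ m * n)%N; pose M := (2 * N + 1)%N.
set u := pow2 m y; pose v := pow2 m (y - x).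
have Su : lspan (bounded_monomials N) u by exact: bounded_monomials_pow2.
have Kuv : ker (u - v) by exact: (repker_pow2 Lam_reg m y Kx).
have M_gt0 : (0 < M)%N by rewrite /M addn1.
have M0 : (M%:R : R[i]) != 0 by rewrite pnatr_eq0 -lt0n.
have [w wP] := prim_root_exists M0.
have wM : w ^+ M = 1 := prim_expr_order wP.
have w1 : `|w| = 1.
  by apply/eqP; rewrite -(@pexpr_eq1 _ _ M)// -normrX wM normr1.
(* Writing the conjugate as a positive power keeps all exponents natural numbers. *)
have wC : (w^*)%R = w ^+ (M - 1).
  have w0 : w != 0 by rewrite -normr_gt0 w1.
  apply: (mulfI w0); rewrite -normCK w1 expr1n -exprS.
  by have -> : (M - 1).+1 = M by rewrite /M; lia.
have wi1 i : `|w ^+ i| = 1 by rewrite normrX w1 expr1n.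
have wiC i : ((w ^+ i)^*)%R = w ^+ ((M - 1) * i).
 by rewrite exprM -wC; exact: rmorphXn.
have [B BP] := choice (fun i => gauge_crossed_product (wi1 i)).
have Bl i : linear (B i) by have [[]] := BP i.
pose P q z := \sum_(i < M) w ^+ (q * i) *: B i z.
have Pl q : linear (P q).
  move=> k a b; rewrite /P scaler_sumr -big_split; apply: eq_bigr => i _.
  by rewrite Bl scalerDr !scalerA mulrC.
have Pmono q k l w1' w2' t z : cp_monomial k l w1' w2' t z ->
    P q z = (if (M %| q + k + (M - 1) * l)%N then M%:R else 0) *: z.
  move=> zP; rewrite -(prim_root_sum _ wP) scaler_suml; apply: eq_bigr => i _.
  have [_ Bm _] := BP i; rewrite (Bm _ _ _ _ _ _ zP) scalerA; congr (_ *: _).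
  rewrite wiC -!exprM -!exprD; congr (_ ^+ _).
  by rewrite mulnDr mulnDr mulnA; lia.
have Pu q : (q < M)%N -> `‖P q u‖ <= M%:R * `‖v‖.
  (* On [u], [P q] is [M] times the projection to degrees congruent to [- q] modulo [M]; [e - e'] is
     the representative of this class between [- N] and [N]. *)
  move=> qM; pose e' := if (q <= N)%N then q else 0%N.
  pose e := if (q <= N)%N then 0%N else (M - q)%N.
  have SP : lspan (homogeneous_monomials e e') (P q u).
    apply: (lspan_linmap (Pl q) _ Su) => z [k [l [z1 [z2 [t [kN lN zP]]]]]].
    rewrite (Pmono _ _ _ _ _ _ _ zP); case: ifP; last first.
      by move=> _; rewrite scale0r; exact: lspan0.
    move=> dvd; apply/lspanZ/subset_lspan; exists k, l, z1, z2, t; split=> //.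
    move: dvd => /dvdnP[a aE]; have {}aE : (q + k + M * l = M * a + l)%N.
      have : ((M - 1) * l + l = M * l)%N.
        by rewrite mulnBl mul1n subnK// leq_pmull.
      by rewrite [(M * a)%N]mulnC -aE; lia.
    (* Since [q + k = M (a - l) + l], the bounds leave only [a = l], where [q <= N], and [a = l.+1],
       where [q > N]. *)
    have [la|al] := ltnP a l.
      have : (M * a.+1 <= M * l)%N by rewrite leq_mul2l la orbT.
      by rewrite mulnS /M in aE *; lia.
    have [al2|al2] := leqP l.+2 a.
      have : (M * l.+2 <= M * a)%N by rewrite leq_mul2l al2 orbT.
      by rewrite !mulnS /M in aE qM *; lia.
    have [al3|al3] : a = l \/ a = l.+1 by lia.
      by subst a; rewrite /e /e'; case: ifP; rewrite /M in aE qM *; lia.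
    subst a; rewrite mulnS in aE.
    by rewrite /e /e'; case: ifP; rewrite /M in aE qM *; lia.
  have KP : ker (P q (u - v)).
    apply: (repker_sum Lam_reg) => i _; apply: (repkerZ Lam_reg).
    by have [_ _] := BP i; apply.
  apply: le_trans (homogeneous_rnorm_le KP SP) _.
  rewrite -(linmapB (Pl q)) subKr /P; apply: le_trans (ler_rnorm_sum _ _ _) _.
  have -> : M%:R * `‖v‖ = \sum_(i < M) `‖v‖.
    by rewrite sumr_const card_ord mulr_natl.
  apply: ler_sum => i _; rewrite rnormZ1 ?normrX ?w1 ?expr1n//.
  by have [Bi _ _] := BP i; exact: star_hom_rnorm.
(* Fourier inversion: summing over [q] kills all terms but [i = 0], and [B 0%N] fixes monomials
   because [w ^+ 0 = 1]. *)
have Psum : \sum_(q < M) P q u = M%:R *: u.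
  have B0u : B 0%N u = u.
    elim: Su => [|k z z' [k1 [l1 [z1 [z2 [t [_ _ zP]]]]]] _ IH].
      by rewrite (linmap0 (Bl _)).
    have [_ Bm _] := BP 0%N; rewrite Bl IH (Bm _ _ _ _ _ _ zP).
    by rewrite expr0 rmorph1 !expr1n mulr1 scale1r.
  rewrite /P exchange_big /=.
  rewrite (bigD1 (Ordinal M_gt0))//= [X in _ + X]big1 ?addr0.
    by rewrite -scaler_suml (prim_root_sum _ wP) dvdn0 B0u.
  move=> i i0; rewrite -scaler_suml (prim_root_sum _ wP) gtnNdvd ?scale0r//.
  by rewrite lt0n; apply: contra i0 => /eqP i0; apply/eqP/val_inj.
have uM : `‖u‖ <= M%:R * `‖v‖.
  have M0R : 0 < M%:R :> R by rewrite ltr0n.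
  rewrite -(ler_pM2l M0R).
  have -> : M%:R * `‖u‖ = `‖M%:R *: u‖.
    by rewrite -(rmorph_nat (real_complex R)) rnormZR ger0_norm// ltW.
  rewrite -Psum; apply: le_trans (ler_rnorm_sum _ _ _) _.
  apply: (@le_trans _ _ (\sum_(q < M) M%:R * `‖v‖)).
    by apply: ler_sum => q _; exact: Pu.
  by rewrite sumr_const card_ord [leRHS]mulr_natl.
rewrite -rnorm_pow2//; apply: le_trans uM _.
apply: (@le_trans _ _ (M%:R * `‖y - x‖ ^+ (2 ^ m))).
  by rewrite ler_wpM2l//; exact: rnorm_pow2_le.
rewrite ler_wpM2r ?exprn_ge0 ?rnorm_ge0// -natrM ler_nat /M /N.
by have := expn_gt0 2 m; nia.
Qed.

(** For an approximant [y] in the span, [|y| <= |y - x|] gives [|x| <= 2 |x - y|]. This bound on [y]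
    follows from the self-adjoint case applied to [y^✶ ⋅ y]. *)
Lemma regular_representation_kernel0 x : ker x -> x = 0.
Proof.
move=> Kx; apply: rnorm_approx0 => e e0.
have [y Sy xy] := cp_monomials_dense x (divr_gt0 e0 (ltr0Sn R 1)).
have Ss : lspan cp_monomials y^✶.
  apply: (lspan_star _ Sy) => z [k [l [w [w' [t P]]]]]; apply: subset_lspan.
  by do 5 eexists; exact: cp_monomial_star P.
have Syy : lspan cp_monomials (y^✶ ⋅ y).
  apply: (lspanM _ Ss Sy).
  move=> z z' [k [l [w [w' [t P]]]]] [k' [l' [v [v' [r P']]]]].
  have [->|PP] := cp_monomialM P P'; first exact: lspan0.
  by apply: subset_lspan; do 5 eexists; exact: PP.
have [n Sn] := cp_monomials_bounded Syy.
have Kyy : ker (y^✶ ⋅ y - (y - x)^✶ ⋅ (y - x)).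
  exact: (repker_star_mul Lam_reg).
have yx : `‖y‖ <= `‖y - x‖.
  rewrite -(@ler_pXn2r _ 2)// ?nnegrE ?rnorm_ge0// -!rnorm_star_mul.
  apply: le_trans (bounded_rnorm_le Kyy Sn _) _; first by rewrite starM starK.
  by rewrite subKr.
rewrite -[x](subrK y) [e]splitr; apply: le_trans (ler_rnormD _ _) (lerD xy _).
by apply: le_trans yx _; rewrite rnormB_sym.
Qed.

End SkewProduct.

Theorem corollary3p2 (R : realType) (E : digraph) (G : groupType)
    (c : edge E -> G) (hE : row_finite E)
    (A : cstarType R)
    (s : edge (skew_product c) -> A) (p : vertex (skew_product c) -> A)
    (hA : graph_cstar s p)
    (gamma : G -> A -> A) (hgamma : cstar_action gamma)
    (gamma_s : forall (t r : G) (f : edge E),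
      gamma t (s (f, r)) = s (f, (r * t^-1)%g))
    (gamma_p : forall (t r : G) (v : vertex E),
      gamma t (p (v, r)) = p (v, (r * t^-1)%g)) :
  amenable_action gamma.
Proof.
move=> F j hj H pi pirep pifaithful K J hJ Lam hLam x y xy.
have [Lrep _] := hLam; apply/subr0_eq.
apply: (regular_representation_kernel0 hE hA hgamma gamma_s gamma_p hj pirep
  pifaithful hJ hLam) => v.
by rewrite (linmapB (rep_linl Lrep v)) xy subrr.
Qed.
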